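(* Let $\mathcal M=(M,<,\ldots)$ be a uniformly locally weakly o-minimal structure of the second kind. Let $A\subseteq M$ and $P\subseteq M^n$ be definable sets with $A$ open, and let $f:A\times P\to\overline M$ be a definable function. For any $(a,b,p)\in M\times M\times M^n$, for any sufficiently small open intervals $I$ and $J$ with $a\in I$, $b\in J$ and any sufficiently small open box $B$ with $p\in B$, the following hold: (1) the set $f^{-1}(\overline J)\cap(I\times\{z\})$ is a union of finitely many points and finitely many open convex sets for all $z\in B$; (2) there exists a partition of $f^{-1}(\overline J)\cap(I\times B)$ into pairwise disjoint definable sets $X_f,X_-,X_+,X_c$ such that for every $z\in B\cap P$: (i) $X_f\cap f^{-1}(\overline J)\cap (I\times\{z\})$ is finite; (ii) $X_c\cap f^{-1}(\overline J)\cap (I\times\{z\})$ is a finite union of open convex sets on which $f$ is locally constant; (iii) $X_-\cap f^{-1}(\overline J)\cap (I\times\{z\})$ is a finite union of open convex sets on which $f$ is locally strictly decreasing; (iv) $X_+\cap f^{-1}(\overline J)\cap (I\times\{z\})$ is a finite union of open convex sets on which $f$ is locally strictly increasing. Furthermore, when $\mathcal M$ is uniformly locally weakly o-minimal of the first kind, one can take $J=M$ and $B=M^n$.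
   Context: $\mathcal M$ is an expansion of a dense linear order without endpoints; ''definable'' means with parameters; order topology on $M$, product topology on $M^n$; open boxes are products of open intervals. For $X\subseteq M^{n+1}$ and $x\in M^n$, $X_x=\{y\in M:(x,y)\in X\}$. $\mathcal M$ is locally weakly o-minimal if for every definable $X\subseteq M$ and $a\in M$ there is an open interval $I\ni a$ with $X\cap I$ a union of a finite set and finitely many open convex sets. It is uniformly locally weakly o-minimal of the second kind if it is locally weakly o-minimal and for every $n\ge1$, definable $X\subseteq M^{n+1}$, $a\in M$, $b\in M^n$, there exist an open interval $I\ni a$ and an open box $B\ni b$ such that $X_x\cap I$ is a union of a finite set and finitely many open convex sets for all $x\in B$; of the first kind if one can always take $B=M^n$. Definable Dedekind completion: a definable gap is a pair $(A,B)$ of nonempty definable subsets of $M$ with $M=A\cup B$, $A<B$, $A$ with no largest and $B$ with no smallest element; $\overline M=M\cup\{\text{definable gaps}\}$ with the natural order; for an interval $J=(b_1,b_2)$, $\overline J=\{x\in\overline M:b_1<x<b_2\}$. For definable $X\subseteq M$ bounded above, $\sup X\in\overline M$ is defined naturally. A definable function $F:X\to\overline M$ ($X\subseteq M^k$ definable) is one of the form $F(x)=\sup Y_x$ for a definable $Y\subseteq M^{k+1}$ whose projection to $M^k$ is $X$. A function on an open subset of $M$ is locally constant (resp. locally strictly increasing/decreasing) if every point has an open interval neighbourhood on which it is constant (resp. strictly increasing/decreasing). Statements about $f$ on a subset of $I\times\{z\}$ refer to $f(\cdot,z)$. *)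

(* Defs.v *)
From mathcomp Require Import all_boot all_order all_algebra.
From mathcomp Require Import all_classical topology.
Set Implicit Arguments.
Unset Strict Implicit.
Unset Printing Implicit Defensive.

Local Open Scope classical_set_scope.

(** The symbols of the language other than [=] and [<], which are built into
    the formulas below: a structure is thus an expansion of [(M, <)]. *)
Record language := Language {
  fsym : Type; far : fsym -> nat;
  rsym : Type; rar : rsym -> nat }.

Record structure (L : language) (M : Type) := Structure {
  fint : forall s : fsym L, (far s).-tuple M -> M;
  rint : forall s : rsym L, set ((rar s).-tuple M) }.

(** [term L M n], [formula L M n]: terms and formulas in the free variables
    [0, ..., n-1], with parameters from [M]. *)
Inductive term (L : language) (M : Type) (n : nat) : Type :=
| Var of 'I_n
| Cst of M
| App (s : fsym L) of ('I_(far s) -> term L M n).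

Inductive formula (L : language) (M : Type) : nat -> Type :=
| Feq n of term L M n & term L M n : formula L M n
| Flt n of term L M n & term L M n : formula L M n
| Frel n (s : rsym L) of ('I_(rar s) -> term L M n) : formula L M n
| Fnot n of formula L M n : formula L M n
| Fand n of formula L M n & formula L M n : formula L M n
| Fexists n of formula L M n.+1 : formula L M n.

Section Definability.
Context {L : language} {d : Order.disp_t} {M : orderTopologicalType d}.
Variable S : structure L M.

Fixpoint eval n (x : n.-tuple M) (t : term L M n) : M :=
  match t with
  | Var i => tnth x i
  | Cst c => c
  | App s ts => fint S [tuple eval x (ts i) | i < far s]
  end.

(** The variable bound by [Fexists] is the last one. *)
Fixpoint sat n (phi : formula L M n) : n.-tuple M -> Prop :=
  match phi with
  | Feq _ t u => fun x => eval x t = eval x u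
  | Flt _ t u => fun x => (eval x t < eval x u)%O
  | Frel _ s ts => fun x => rint S [tuple eval x (ts i) | i < rar s]
  | Fnot _ psi => fun x => ~ sat psi x
  | Fand _ psi chi => fun x => sat psi x /\ sat chi x
  | Fexists _ psi => fun x => exists y, sat psi (rcons_tuple x y)
  end.

Definition definable n (X : set (n.-tuple M)) : Prop :=
  exists phi : formula L M n, X = [set x | sat phi x].

(** Subsets of [M] are identified with subsets of [M^1]. *)
Definition definable1 (X : set M) : Prop :=
  definable [set x : 1.-tuple M | X (thead x)].

End Definability.

Section Order.
Context {d : Order.disp_t} {M : orderTopologicalType d}.

Definition dlo_without_endpoints : Prop :=
  [/\ forall x y : M, (x < y)%O -> exists z : M, (x < z < y)%O,
      forall x : M, exists y : M, (y < x)%O &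
      forall x : M, exists y : M, (x < y)%O].

Definition open_itv_at (a : M) (I : interval M) : Prop :=
  itv_open_ends I /\ a \in I.

Definition box n (B : 'I_n -> interval M) : set (n.-tuple M) :=
  [set x | forall i, tnth x i \in B i].

Definition open_box_at n (b : n.-tuple M) (B : 'I_n -> interval M) : Prop :=
  forall i, open_itv_at (tnth b i) (B i).

Definition convex (C : set M) : Prop :=
  forall x y, C x -> C y -> forall z, (x <= z <= y)%O -> C z.

Definition finite_union_open_convex (U : set M) : Prop :=
  exists m (C : 'I_m -> set M),
    (forall i, open (C i) /\ convex (C i)) /\ U = \bigcup_i C i.

Definition finite_union_points_open_convex (X : set M) : Prop :=
  exists F U : set M,
    [/\ finite_set F, finite_union_open_convex U & X = F `|` U].

(** [X_x = {y | (x, y) \in X}]: fiber over the first [n] coordinates. *)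
Definition fiber n (X : set (n.+1.-tuple M)) (x : n.-tuple M) : set M :=
  [set y | X (rcons_tuple x y)].

(** [{x | (x, z) \in X}]: the subset of [M] identified with
    [X `&` (M x {z})], fiber over the last [n] coordinates. *)
Definition slice n (X : set (n.+1.-tuple M)) (z : n.-tuple M) : set M :=
  [set x | X (cons_tuple x z)].

Definition prodset n (A : set M) (P : set (n.-tuple M)) :
    set (n.+1.-tuple M) :=
  [set w | exists x z, [/\ A x, P z & w = cons_tuple x z]].

End Order.
Arguments dlo_without_endpoints {d} M.

Section LocalWeakOminimality.
Context {L : language} {d : Order.disp_t} {M : orderTopologicalType d}.
Variable S : structure L M.

Definition locally_weakly_ominimal : Prop :=
  forall (X : set M) (a : M), definable1 S X ->
  exists2 I, open_itv_at a I &
    finite_union_points_open_convex (X `&` [set` I]).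

Definition unif_locally_weakly_ominimal2 : Prop :=
  locally_weakly_ominimal /\
  forall n (X : set (n.+1.-tuple M)) (a : M) (b : n.-tuple M),
  (0 < n)%N -> definable S X ->
  exists I B, [/\ open_itv_at a I, open_box_at b B &
    forall x, box B x ->
      finite_union_points_open_convex (fiber X x `&` [set` I])].

Definition unif_locally_weakly_ominimal1 : Prop :=
  locally_weakly_ominimal /\
  forall n (X : set (n.+1.-tuple M)) (a : M),
  (0 < n)%N -> definable S X ->
  exists2 I, open_itv_at a I &
    forall x, finite_union_points_open_convex (fiber X x `&` [set` I]).

End LocalWeakOminimality.

Section Completion.
Context {L : language} {d : Order.disp_t} {M : orderTopologicalType d}.
Variable S : structure L M.

Record gap := Gap {
  glow : set M;
  ghigh : set M;
  glow_def : definable1 S glow;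
  ghigh_def : definable1 S ghigh;
  glow_neq0 : glow !=set0;
  ghigh_neq0 : ghigh !=set0;
  gap_cover : glow `|` ghigh = setT;
  gap_lt : forall x y, glow x -> ghigh y -> (x < y)%O;
  glow_nomax : ~ exists2 x, glow x & forall y, glow y -> (y <= x)%O;
  ghigh_nomin : ~ exists2 x, ghigh x & forall y, ghigh y -> (x <= y)%O }.

Inductive completion := Pt of M | GapPt of gap.

Definition clt (s t : completion) : Prop :=
  match s, t with
  | Pt x, Pt y => (x < y)%O
  | Pt x, GapPt g => glow g x
  | GapPt g, Pt y => ghigh g y
  | GapPt g, GapPt h => glow g `<` glow h
  end.

Definition cle (s t : completion) : Prop := s = t \/ clt s t.

(** The interval of the completion with the same endpoints as the open
    interval [J]; in particular it is everything when [J] is [`]-oo, +oo[]. *)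
Definition itv_bar (J : interval M) : set completion :=
  [set s | match J with Interval l u =>
     match l with
     | BSide _ b1 => clt (Pt b1) s
     | BInfty b => b
     end /\
     match u with
     | BSide _ b2 => clt s (Pt b2)
     | BInfty b => ~~ b
     end end].

Definition is_sup (Y : set M) (s : completion) : Prop :=
  (forall y, Y y -> cle (Pt y) s) /\
  (forall t, (forall y, Y y -> cle (Pt y) t) -> cle s t).

(** [F], restricted to [X], is a definable function [X -> completion]; the
    values of [F] outside of [X] are irrelevant. *)
Definition definable_fun k (X : set (k.-tuple M))
    (F : k.-tuple M -> completion) : Prop :=
  exists Y : set (k.+1.-tuple M),
    [/\ definable S Y, [set x | fiber Y x !=set0] = X &
        forall x, X x -> is_sup (fiber Y x) (F x)].

Definition locally_on (Q : set M -> Prop) (U : set M) : Prop :=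
  forall x, U x ->
  exists I, [/\ open_itv_at x I, [set` I] `<=` U & Q [set` I]].

Definition locally_constant (g : M -> completion) : set M -> Prop :=
  locally_on (fun K => forall x y, K x -> K y -> g x = g y).

Definition locally_increasing (g : M -> completion) : set M -> Prop :=
  locally_on (fun K => forall x y, K x -> K y -> (x < y)%O -> clt (g x) (g y)).

Definition locally_decreasing (g : M -> completion) : set M -> Prop :=
  locally_on (fun K => forall x y, K x -> K y -> (x < y)%O -> clt (g y) (g x)).

Variables (n : nat) (A : set M) (P : set (n.-tuple M)).
Variable f : n.+1.-tuple M -> completion.

(** [f^-1(itv_bar J)] for [f] with domain [A x P]. *)
Definition preim_bar (J : interval M) : set (n.+1.-tuple M) :=
  prodset A P `&` f @^-1` itv_bar J.

Definition tame_slices (I J : interval M) (B : 'I_n -> interval M) : Prop :=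
  forall z, box B z ->
    finite_union_points_open_convex (slice (preim_bar J) z `&` [set` I]).

Definition monotone_partition
    (I J : interval M) (B : 'I_n -> interval M) : Prop :=
  exists Xf Xm Xp Xc : set (n.+1.-tuple M),
  [/\ [/\ definable S Xf, definable S Xm, definable S Xp & definable S Xc],
      Xf `|` Xm `|` Xp `|` Xc = preim_bar J `&` prodset [set` I] (box B),
      trivIset [set: 'I_4] (tnth [tuple Xf; Xm; Xp; Xc]) &
      forall z, (box B `&` P) z ->
      let on X := slice (X `&` preim_bar J) z `&` [set` I] in
      let fz x := f (cons_tuple x z) in
      [/\ finite_set (on Xf),
          finite_union_open_convex (on Xc) /\ locally_constant fz (on Xc),
          finite_union_open_convex (on Xm) /\ locally_decreasing fz (on Xm) &
          finite_union_open_convex (on Xp) /\ locally_increasing fz (on Xp)]].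

End Completion.

(* Main.v *)
(** Everything rests on one fact about a single function [g] on an interval: if
    every [x] satisfies [g y < g x] for all [y] close to [x] on its left, then
    [g] is strictly increasing on some subinterval.  Call [x > c] a left record
    from [c] if [g y < g x] for all [y] in [[c, x)].  On the set of left records
    from [c] the function [g] is strictly increasing, so if no subinterval as
    above exists, then this tame set contains no interval and is finite.  Send
    [c] to the least left record from [c].  The fibre of this map over [x] is
    tame, hence contains or avoids a left neighbourhood of [x].  It cannot
    contain one, since any [y < x] in it is a left record from the points close to
    [y] on its left; and it cannot avoid one, since for [c] close to [x] the
    last left record from [c] below [x] (or [c], if there is none) lies in it.

    By tameness one of the relations [g y < g x], [g y = g x], [g y > g x] holds
    on a left neighbourhood of each [x], so every interval has a subinterval on
    which [g] is constant or strictly monotone, and the tame set of points near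
    which [g] is neither is finite.  Only finitely many definable families are
    used, so a single interval and a single box serve for all of them; the
    interval [J] is handled by treating its endpoints as two more parameters. *)
Require Import Defs.
From mathcomp Require Import all_boot all_order all_algebra.
From mathcomp Require Import all_classical topology.
Import Order.TTheory.

Set Implicit Arguments.
Unset Strict Implicit.

Local Open Scope order_scope.
Local Open Scope classical_set_scope.

Local Notation tame := finite_union_points_open_convex.

(** * Tame sets and monotonicity in a dense linear order *)

Section Tame.
Context {d : Order.disp_t} {M : orderTopologicalType d}.
Hypothesis dlo : dlo_without_endpoints M.
Implicit Types (x y z t u v l : M) (X Y F U C : set M).

Let between x y : x < y -> exists z, x < z < y.
Proof. by case: dlo => + _ _; apply. Qed.

Let below x : exists y, y < x.
Proof. by case: dlo. Qed.

Let above x : exists y, x < y.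
Proof. by case: dlo. Qed.

(** * Open intervals and finite unions of open convex sets *)

Lemma open_ends_itv (I : interval M) x : open_itv_at x I ->
  exists l v, l < x < v /\ (forall y, l < y < v -> [set` I] y).
Proof.
case: I => [[[] s|[]] [[] t|[]]] [] //= _; rewrite !in_itv //= => xI.
- by exists s, t; split => // y; rewrite in_itv.
- have [v xv] := above x; exists s, v; split; first by move/andP: xI => [-> _].
  by move=> y; rewrite in_itv /= andbT => /andP[].
- have [l lx] := below x; exists l, t; split; first by rewrite lx.
  by move=> y; rewrite in_itv /= => /andP[].
- have [l lx] := below x; have [v xv] := above x.
  by exists l, v; split => [|y _]; [rewrite lx|rewrite in_itv].
Qed.

Lemma open_itv_nbhs U x :
  open U -> U x -> exists l v, l < x < v /\ (forall y, l < y < v -> U y).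
Proof.
rewrite openE => oU /oU; rewrite /interior itv_nbhsE => -[I /open_ends_itv].
by move=> [l [v [lxv sI]]] sU; exists l, v; split => // y /sI/sU.
Qed.

Lemma open_itv_oo l v x : l < x < v -> open_itv_at x `]l, v[%O.
Proof. by split => //; rewrite in_itv. Qed.

Lemma open_ends_convex (I : interval M) : convex [set` I].
Proof.
move=> x y /= xI yI z /andP[xz zy]; move: xI yI.
case: I => a b; rewrite !itv_boundlr => /andP[ax _] /andP[_ yb]; apply/andP.
by split; [apply: le_trans ax _|apply: le_trans yb]; rewrite bnd_simp.
Qed.

Lemma oo_convex l v : convex [set x | l < x < v].
Proof.
move=> x y /andP[lx _] /andP[_ yv] z /andP[xz zy] /=.
by rewrite (lt_le_trans lx) ?(le_lt_trans zy).
Qed.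

Lemma itv_ooE l v : [set` `]l, v[%O] = [set x | l < x < v].
Proof. by apply/seteqP; split => x /=; rewrite in_itv. Qed.

Lemma oo_open l v : open [set x | l < x < v].
Proof. by rewrite -itv_ooE; exact: itv_open. Qed.

Lemma open_ooP (U : set M) :
  (forall x, U x -> exists l v, l < x < v /\ forall y, l < y < v -> U y) -> open U.
Proof.
move=> hU; rewrite openE => x /hU[l [v [lxv sU]]]; rewrite /interior itv_nbhsE.
by exists `]l, v[%O; [exact: open_itv_oo|move=> y /=; rewrite in_itv; exact: sU].
Qed.

(** Any finite type may index the union, so that products and sums can serve as index sets. *)
Lemma fuoc_fin (T : finType) (C : T -> set M) :
  (forall i, open (C i) /\ convex (C i)) ->
  finite_union_open_convex [set x | exists i, C i x].
Proof.
move=> hC; exists #|T|, (fun i => C (enum_val i)); split => [i|]; first exact: hC.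
apply/seteqP; split=> x /= [i].
  by move=> Cx; exists (enum_rank i) => //; rewrite enum_rankK.
by move=> _ Cx; exists (enum_val i).
Qed.

Lemma fuocE U : finite_union_open_convex U ->
  exists m (C : 'I_m -> set M), (forall i, open (C i) /\ convex (C i)) /\
    forall x, U x <-> exists i, C i x.
Proof.
move=> [m [C [hC ->]]]; exists m, C; split => // x; split => [[i _ Cx]|[i Cx]].
  by exists i.
by exists i.
Qed.

Lemma fuoc_ext U V : (forall x, U x <-> V x) ->
  finite_union_open_convex U -> finite_union_open_convex V.
Proof. by move=> UV; congr finite_union_open_convex; apply/seteqP; split => x /UV. Qed.

Lemma fuoc_setI U V : finite_union_open_convex U -> finite_union_open_convex V ->
  finite_union_open_convex (U `&` V).
Proof.
move=> /fuocE[m [C [hC CU]]] /fuocE[k [D [hD DV]]].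
apply: (@fuoc_ext [set x | exists i : 'I_m * 'I_k, (C i.1 `&` D i.2) x]).
  move=> x; split => /= [[[i j] /= [Ci Dj]]|[/CU[i Ci] /DV[j Dj]]].
    by split; [apply/CU; exists i|apply/DV; exists j].
  by exists (i, j).
apply: fuoc_fin => -[i j] /=; split.
  by apply: openI; [exact: (hC i).1|exact: (hD j).1].
by move=> x y [Cx Dx] [Cy Dy] z xzy; split; [apply: (hC i).2 xzy|apply: (hD j).2 xzy].
Qed.

Lemma fuoc_convex C : open C -> convex C -> finite_union_open_convex C.
Proof.
move=> oC cC; apply: (@fuoc_ext [set x | exists i : unit, C x]); last exact: fuoc_fin.
by move=> x; split => [[]//|Cx]; exists tt.
Qed.

Lemma fuoc_open U : finite_union_open_convex U -> open U.
Proof. by move=> [m [C [hC ->]]]; apply: bigcup_open => i _; case: (hC i). Qed.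

(** Each point of [F] lying in [X] has an open interval around it inside the open set [X]; replacing
    these points by such intervals leaves only open convex sets. *)
Lemma open_tame_fuoc X F U : open X -> finite_set F -> finite_union_open_convex U ->
  U `<=` X -> X `<=` F `|` U -> finite_union_open_convex X.
Proof.
move=> oX /finite_seqP[s ->] /fuocE[m [C [hC CU]]] UX XFU.
have /choice[N hN] (q : seq_sub s) :
    exists N : set M, [/\ open N, convex N, N `<=` X & X (val q) -> N (val q)].
  have [/(open_itv_nbhs oX)[l [v [lqv sX]]]|nX] := pselect (X (val q)).
    exists [set x | l < x < v]; split => //; first exact: oo_open.
    exact: oo_convex.
  exists set0; split => //; exact: open0.
pose G (i : 'I_m + seq_sub s) := match i with inl i => C i | inr q => N q end.
apply: (@fuoc_ext [set x | exists i, G i x]) => [x|]; last first.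
  by apply: fuoc_fin => -[i|q] /=; [exact: hC|case: (hN q)].
split => [[[i|q] /= Gx]|Xx]; first by apply: UX; apply/CU; exists i.
  by case: (hN q) => _ _ + _; apply.
case: (XFU _ Xx) => [/= xs|/CU[i Cx]]; last by exists (inl i).
by exists (inr (SeqSub xs)); case: (hN (SeqSub xs)) => _ _ _; apply.
Qed.

Lemma tame_setI X Y : tame X -> tame Y -> tame (X `&` Y).
Proof.
move=> [F [U [fF fU ->]]] [G [V [fG fV ->]]].
(* A point of the intersection outside [F] and [G] lies in both [U] and [V]; the others form a
   subset of a finite set. *)
exists ((F `|` U) `&` (G `|` V) `&` (F `|` G)), (U `&` V); split.
- by apply: sub_finite_set (_ : finite_set (F `|` G)) => [x []|] //; rewrite finite_setU.
- exact: fuoc_setI.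
- apply/seteqP; split => x; last first.
    by move=> [[]|[Ux Vx]] //; split; right.
  move=> [FUx GVx]; case: (FUx) => [Fx|Ux]; last case: (GVx) => [Gx|Vx].
  + by left; split => //; left.
  + by left; split => //; right.
  + by right.
Qed.

Lemma fuoc_tame U : finite_union_open_convex U -> tame U.
Proof. by move=> fU; exists set0, U; split => //; rewrite set0U. Qed.

(** This is closure under intersection, as [I] is itself open and convex. *)
Lemma tame_sub_itv X (I J : interval M) : itv_open_ends I ->
  [set` I] `<=` [set` J] -> tame (X `&` [set` J]) -> tame (X `&` [set` I]).
Proof.
move=> oI IJ tX; have -> : X `&` [set` I] = X `&` [set` J] `&` [set` I].
  by rewrite -setIA; congr setI; apply/seteqP; split => [x Ix|x []]; first by split=> //; apply: IJ.
apply: tame_setI => //; apply/fuoc_tame/fuoc_convex; last exact: open_ends_convex.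
exact: itv_open_ends_open.
Qed.

(** * Tame sets to the left of a point *)

Definition left_decided X x :=
  exists2 t, t < x & (forall y, t < y < x -> X y) \/ (forall y, t < y < x -> ~ X y).

Definition finite_or_itv X :=
  finite_set X \/ exists l v, l < v /\ forall y, l < y < v -> X y.

Lemma left_decidedU X Y x :
  left_decided X x -> left_decided Y x -> left_decided (X `|` Y) x.
Proof.
move=> [t tx hX] [u ux hY]; exists (Order.max t u); first by rewrite gt_max tx.
case: hX => hX; last case: hY => hY.
- by left=> y; rewrite gt_max => /andP[/andP[ty uy] yx]; left; apply: hX; rewrite ty.
- by left=> y; rewrite gt_max => /andP[/andP[ty uy] yx]; right; apply: hY; rewrite uy.
- right=> y; rewrite gt_max => /andP[/andP[ty uy] yx] [Xy|Yy].
    by apply: (hX y) => //; rewrite ty.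
  by apply: (hY y) => //; rewrite uy.
Qed.

Lemma left_decided_ext X Y x t : t < x -> (forall y, t < y < x -> (X y <-> Y y)) ->
  left_decided X x -> left_decided Y x.
Proof.
move=> tx XY [u ux hX]; exists (Order.max t u); first by rewrite gt_max tx.
have tux y : Order.max t u < y < x -> t < y < x /\ u < y < x.
  by rewrite gt_max => /andP[/andP[-> ->] ->].
by case: hX => hX; [left|right] => y /tux[/XY[XYy YXy] /hX] //; auto.
Qed.

Lemma left_decided_bigcup m (C : 'I_m -> set M) x :
  (forall i, left_decided (C i) x) -> left_decided [set y | exists i, C i y] x.
Proof.
elim: m C => [|m IH] C hC.
  by have [t tx] := below x; exists t => //; right => y _ [[]].
have [t tx] := below x.
apply: (left_decided_ext tx _ (left_decidedU (hC ord0) (IH (C \o lift ord0) _))).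
  move=> y _; split => [[Cy|[i Cy]]|[i]]; [by exists ord0|by exists (lift ord0 i)|].
  by case: (unliftP ord0 i) => [j|] -> Cy; [right; exists j|left].
by move=> i; apply: hC.
Qed.

(** If [C] has points arbitrarily close to [x] on the left, convexity puts into [C] everything
    between one of them and [x]; otherwise [C] misses a left neighbourhood. *)
Lemma left_decided_convex C x : convex C -> left_decided C x.
Proof.
move=> cC; have [[c [cx Cc hc]]|nC] :=
    pselect (exists c, [/\ c < x, C c & forall t, t < x -> exists2 y, t < y < x & C y]).
  exists c => //; left=> y /andP[cy yx].
  have [y' /andP[yy' _] Cy'] := hc y yx.
  by apply: (cC c y') => //; rewrite !ltW.
have [[t tx ht]|nt] := pselect (exists2 t, t < x & forall y, t < y < x -> ~ C y).
  by exists t => //; right.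
have h t : t < x -> exists2 y, t < y < x & C y.
  move=> tx; apply: contrapT => ny; apply: nt; exists t => // y tyx Cy.
  by apply: ny; exists y.
have [t tx] := below x; have [c /andP[tc cx] Cc] := h _ tx.
by exfalso; apply: nC; exists c.
Qed.

Lemma left_decided_finite F x : finite_set F -> left_decided F x.
Proof.
move=> /finite_seqP[s ->]; elim: s => [|q s IH].
  by have [t tx] := below x; exists t => //; right.
have [t tx] := below x; apply: (left_decided_ext tx _ (left_decidedU (X := [set q]) _ IH)).
  move=> y _ /=; rewrite inE; split; first by case=> [->|->]; rewrite ?eqxx ?orbT.
  by case/orP => [/eqP|]; [left|right].
by apply: left_decided_convex => a b -> -> z; rewrite -eq_le => /eqP.
Qed.

Lemma tame_left_decided X (I : interval M) x : itv_open_ends I -> x \in I ->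
  tame (X `&` [set` I]) -> left_decided X x.
Proof.
move=> oI xI [F [U [fF /fuocE[m [C [hC CU]]] XE]]].
have [l [v [/andP[lx xv] sI]]] := open_ends_itv (conj oI xI).
apply: (left_decided_ext lx _ (left_decidedU (left_decided_finite x fF)
   (left_decided_bigcup (C := C) _))) => [y /andP[ly yx]|i].
  have -> : X y <-> (X `&` [set` I]) y.
    by split => [|[]//]; split => //; apply: sI; rewrite ly (lt_trans yx).
  by rewrite XE; split => -[Fy|/CU Uy]; by [left|right].
by apply: left_decided_convex; case: (hC i).
Qed.

(** A convex set with two points contains the interval between them; if no [C i] has two points, the
    union is finite. *)
Lemma tame_finite_or_itv X : tame X -> finite_or_itv X.
Proof.
move=> [F [U [fF /fuocE[m [C [hC CU]]] ->]]].
have [[i [x [y [Cx Cy xy]]]]|nC] := pselect (exists i x y, [/\ C i x, C i y & x < y]).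
  right; exists x, y; split => // z /andP[xz zy]; right; apply/CU; exists i.
  by apply: (hC i).2 Cx Cy _ _; rewrite !ltW.
left; rewrite finite_setU; split => //.
apply: sub_finite_set (_ : finite_set (\bigcup_(i in [set: 'I_m]) C i)) => [x /CU[i Cx]|].
  by exists i.
apply: bigcup_finite => // i _.
have [[x Cx]|] := pselect (C i !=set0); last by rewrite nonemptyPn => ->.
suff -> : C i = [set x] by exact: finite_set1.
apply/seteqP; split => [y Cy|_ ->] //=.
by have [yx|xy|] // := ltgtP y x; exfalso; apply: nC; exists i; [exists y, x|exists x, y].
Qed.

(** * Left records and monotone subintervals *)

Definition mono_itv (r : M -> M -> Prop) l v :=
  forall x y, l < x < v -> l < y < v -> x < y -> r x y.

Definition left_record (r : M -> M -> Prop) c : set M :=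
  [set x | c < x /\ forall y, c <= y < x -> r y x].

(** The fibre over [x] of the map sending [c] to the least left record from [c]. *)
Definition left_children (r : M -> M -> Prop) x : set M :=
  [set c | left_record r c x /\ forall y, left_record r c y -> x <= y].

Lemma finite_max F : finite_set F -> F !=set0 -> exists2 x, F x & forall y, F y -> y <= x.
Proof.
move=> /finite_seqP[s ->] {F}; elim: s => [[? //]|q s IH] _.
have [/IH[x xs hx]|/set0P/negP/negPn/eqP s0] := pselect (([set` s] : set M) !=set0).
  exists (Order.max q x) => [|y] /=; first by case: ltP => _; rewrite !inE ?eqxx ?xs ?orbT.
  by rewrite inE le_max => /orP[/eqP->|/hx ->]; rewrite ?lexx ?orbT.
exists q => /= [|y]; first by rewrite inE eqxx.
by rewrite inE => /orP[/eqP->|ys] //; have : ([set` s] : set M) y by []; rewrite s0.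
Qed.

(** The relation [r y x] stands for [g y < g x] or for its reverse: both are transitive, so one
    argument yields increasing and decreasing pieces. *)
Lemma exists_increasing_itv (r : M -> M -> Prop) l v : l < v ->
  (forall x y z, r x y -> r y z -> r x z) ->
  (forall x, l < x < v -> exists2 t, t < x & forall y, t < y < x -> r y x) ->
  (forall c, l < c < v -> finite_or_itv (left_record r c `&` [set x | l < x < v])) ->
  (forall x, l < x < v -> left_decided (left_children r x) x) ->
  exists l' v', [/\ l <= l', l' < v', v' <= v & mono_itv r l' v'].
Proof.
move=> lv rtr left_r rec_fin child_dec; apply: contrapT => nmono.
(* Left records [x < y] from the same [c] satisfy [r x y], since [c <= x < y]; an interval of them
   would be one excluded by [nmono]. *)
have {}rec_fin c : l < c < v -> finite_set (left_record r c `&` [set x | l < x < v]).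
  move=> lcv; case: (rec_fin c lcv) => // -[s [t [st sub]]]; exfalso; apply: nmono.
  exists (Order.max l s), (Order.min v t); have [m smt] := between st.
  have [[[cm _] /andP[lm mv]] [sm mt]] := (sub m smt, andP smt).
  split; rewrite ?le_max ?lexx ?ge_min ?lexx //.
    by apply: (@lt_trans _ _ m); rewrite ?gt_max ?lt_min ?lm ?mv ?sm.
  move=> x y; rewrite !gt_max !lt_min.
  move=> /andP[/andP[_ sx] /andP[_ xt]] /andP[/andP[_ sy] /andP[_ yt]] xy.
  have [[cx _] _] := sub x ltac:(by rewrite sx).
  have [[_ hy] _] := sub y ltac:(by rewrite sy).
  by apply: hy; rewrite xy ltW.
have [x lxv] := between lv; have [lx xv] := andP lxv.
have near_rec y : l < y < v -> exists t, [/\ l <= t, t < y & forall c, t < c < y -> left_record r c y].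
  move=> /[dup] /andP[ly _] /left_r[t ty ht]; exists (Order.max l t).
  rewrite le_max lexx gt_max ly; split => // c /andP[+ cy]; rewrite gt_max => /andP[_ tc].
  by split => // w /andP[cw wy]; apply: ht; rewrite wy (lt_le_trans tc).
have [t0 [lt0 t0x rec_x]] := near_rec _ lxv.
have [t tx hchild] := child_dec _ lxv.
have [s [st0 s_t sx]] : exists s, [/\ t0 <= s, t <= s & s < x].
  by exists (Order.max t0 t); rewrite !le_max !lexx orbT gt_max t0x.
case: hchild => hchild.
  (* The fibre fills a left neighbourhood of [x]. A point [y] there is a left record from points [c]
     just below it, so [x] is not the least one. *)
  have [y /andP[sy yx]] := between sx.
  have [t1 [lt1 t1y rec_y]] := near_rec y ltac:(by rewrite (le_lt_trans lt0) ?(le_lt_trans st0) ?(lt_trans yx)).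
  have [c /andP[+ cy]] : exists c, Order.max s t1 < c < y.
    by apply: between; rewrite gt_max sy.
  rewrite gt_max => /andP[sc t1c].
  have [_ /(_ y)] := hchild c ltac:(by rewrite (le_lt_trans s_t) //= (lt_trans cy)).
  by rewrite leNgt yx => /(_ (rec_y c ltac:(by rewrite t1c))).
(* The fibre misses a left neighbourhood of [x]. Then [y], the last left record from [c] below [x]
   or else [c] itself, gives a contradiction by lying in the fibre. *)
have [c /andP[sc cx]] := between sx.
have lcv : l < c < v by rewrite (le_lt_trans lt0) ?(le_lt_trans st0) ?(lt_trans cx).
have rec_cx : left_record r c x by apply: rec_x; rewrite cx (le_lt_trans st0).
pose G := [set c] `|` (left_record r c `&` [set y | l < y < v] `&` [set y | y < x]).
have [|y Gy ymax] := @finite_max G _ (ex_intro _ c (or_introl erefl)).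
  rewrite finite_setU; split; first exact: finite_set1.
  by apply: sub_finite_set (rec_fin c lcv) => ? [].
have [cy yx] : c <= y /\ y < x.
  by case: Gy => [->|[[[cy _] _] yx]]; rewrite ?lexx // ltW.
have rec_cy : c < y -> left_record r c y by case: Gy => [->|[[]]//]; rewrite ltxx.
apply: (hchild y); first by rewrite yx (lt_le_trans _ cy) // (le_lt_trans s_t).
split.
  by split => // w /andP[yw wx]; apply: rec_cx.2; rewrite wx (le_trans cy).
(* A left record [w < x] from [y] would be one from [c] too, by transitivity through [y], and so an
   element of [G] above its maximum. *)
move=> w rec_yw; rewrite leNgt; apply/negP => wx; have [yw hw] := rec_yw.
suff : G w by move/ymax; rewrite leNgt yw.
right; split => //; split; last first.
  by rewrite /= (lt_trans _ yw) ?(lt_le_trans _ cy) ?(lt_trans wx) //; case/andP: lcv.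
split; first exact: le_lt_trans yw.
move=> u /andP[cu uw]; have [yu|uy] := leP y u; first by apply: hw; rewrite yu.
apply: (rtr _ y); last by apply: hw; rewrite lexx.
by apply: (rec_cy (le_lt_trans cu uy)).2; rewrite cu.
Qed.

(** By [lentr] incomparability for [lt] is transitive; it stands for equality of values. On the left
    of each point one of three relations prevails: equality yields a constant interval at once, and
    the other two are left to the record argument, on an interval where only one of them occurs. *)
Lemma exists_mono_itv (lt : M -> M -> Prop) l v : l < v ->
  (forall x y z, lt x y -> lt y z -> lt x z) ->
  (forall x y z, ~ lt x y -> ~ lt y z -> ~ lt x z) ->
  (forall s : bool, let r x y := if s then lt x y else lt y x in
   [/\ forall x, l < x < v -> left_decided [set y | r y x] x,
       forall x, l < x < v -> left_decided [set x | exists2 t, t < x & forall y, t < y < x -> r y x] x,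
       forall c l' v', l < c < v -> l <= l' -> v' <= v ->
         finite_or_itv (left_record r c `&` [set x | l' < x < v']) &
       forall x, l < x < v -> left_decided (left_children r x) x]) ->
  exists l' v', [/\ l <= l', l' < v', v' <= v &
    [\/ mono_itv lt l' v', mono_itv (fun x y => lt y x) l' v' |
        mono_itv (fun x y => ~ lt x y /\ ~ lt y x) l' v']].
Proof.
move=> lv ltr lentr hdec; apply: contrapT => nmono.
(* By the record argument, the points of a subinterval cannot all be of increasing type or all of
   decreasing type. *)
have mono_lt (s : bool) l' v' : l <= l' -> l' < v' -> v' <= v ->
    ~ (forall x, l' < x < v' -> exists2 t, t < x & forall y, t < y < x -> if s then lt y x else lt x y).
  move=> ll lv' vv hs; have [_ _ hrec hch] := hdec s.
  have sub x : l' < x < v' -> l < x < v.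
    by move=> /andP[lx xv]; rewrite (le_lt_trans ll) ?(lt_le_trans xv).
  have [||||l2 [v2 [ll2 lv2 vv2 hmono]]] :=
      @exists_increasing_itv (fun x y => if s then lt x y else lt y x) l' v' lv'.
  - by move=> x y z; case: (s) => ? ?; apply: (ltr _ y).
  - exact: hs.
  - by move=> c /sub/hrec; apply.
  - by move=> x /sub/hch.
  apply: nmono; exists l2, v2; split; [exact: le_trans ll2|by []|exact: le_trans vv|].
  by case: (s) hmono; [constructor 1|constructor 2].
have [hlt hlt2 _ _] := hdec true; have [hgt _ _ _] := hdec false.
have types x : l < x < v -> exists t, [/\ l <= t, t < x & [\/ forall y, t < y < x -> lt y x,
    forall y, t < y < x -> lt x y | forall y, t < y < x -> ~ lt x y /\ ~ lt y x]].
  move=> /[dup] lxv /andP[lx xv]; have [t tx ht] := hlt x lxv; have [u ux hu] := hgt x lxv.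
  exists (Order.max l (Order.max t u)); rewrite le_max lexx !gt_max lx tx ux; split => //.
  case: ht => ht; last case: hu => hu.
  - by constructor 1 => y; rewrite !gt_max => /andP[/and3P[_ ty _] yx]; apply: ht; rewrite ty.
  - by constructor 2 => y; rewrite !gt_max => /andP[/and3P[_ _ uy] yx]; apply: hu; rewrite uy.
  - constructor 3 => y; rewrite !gt_max => /andP[/and3P[_ ty uy] yx].
    by split; [apply: hu; rewrite uy|apply: ht; rewrite ty].
(* Incomparability with [x] on all of [(t, x)] would make the function constant there, so only two
   types remain. *)
have {}types x : l < x < v -> (exists2 t, t < x & forall y, t < y < x -> lt y x) \/
    (exists2 t, t < x & forall y, t < y < x -> lt x y).
  move=> lxv; have [t [lt_ tx [ht|ht|ht]]] := types x lxv; [by left; exists t|by right; exists t|].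
  exfalso; apply: nmono; exists t, x; split => //; first by rewrite ltW; case/andP: lxv.
  constructor 3 => y w /ht[xy yx] /ht[xw wx] _.
  by split; [apply: (lentr _ x)|apply: (lentr _ x)].
have [x /[dup] lxv /andP[lx xv]] := between lv.
(* The set of points of increasing type is itself decided on the left of [x], so all points of some
   left neighbourhood share one type. *)
have [t tx ht] := hlt2 x lxv.
have mx : l <= Order.max l t by rewrite le_max lexx.
have mxx : Order.max l t < x by rewrite gt_max lx.
case: ht => ht; [apply: (mono_lt true _ _ mx mxx (ltW xv))|apply: (mono_lt false _ _ mx mxx (ltW xv))];
  move=> y; rewrite gt_max => /andP[/andP[ly ty] yx]; have := ht y; rewrite /= ty yx => /(_ isT) // nlt.
by case: (types y) => //; rewrite ly (lt_trans yx).
Qed.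
End Tame.

(** * Definable predicates *)

Section Definability.
Context {L : language} {d : Order.disp_t} {M : orderTopologicalType d}.
Variable S : structure L M.

Fixpoint rename_term m n (g : 'I_m -> 'I_n) (t : term L M m) : term L M n :=
  match t with
  | Var i => Var _ _ (g i)
  | Cst c => Cst _ _ c
  | App s ts => App (fun i => rename_term g (ts i))
  end.

Lemma eval_rename m n (g : 'I_m -> 'I_n) (x : n.-tuple M) (t : term L M m) :
  Defs.eval S x (rename_term g t) = Defs.eval S [tuple tnth x (g i) | i < m] t.
Proof.
elim: t => [i|c|s ts IH] //=; first by rewrite tnth_mktuple.
by congr fint; apply: eq_from_tnth => i; rewrite !tnth_mktuple.
Qed.

Lemma tnth_rcons_max n (x : n.-tuple M) y : tnth (rcons_tuple x y) ord_max = y.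
Proof. by rewrite (tnth_nth y) /= nth_rcons size_tuple ltnn eqxx. Qed.

Lemma tnth_rcons_lift n (x : n.-tuple M) y i :
  tnth (rcons_tuple x y) (lift ord_max i) = tnth x i.
Proof.
by rewrite !(tnth_nth y) lift_max /= nth_rcons size_tuple ltn_ord.
Qed.

Lemma rename_formula m (phi : formula L M m) : forall n (g : 'I_m -> 'I_n),
  exists psi : formula L M n,
    forall x, sat S psi x <-> sat S phi [tuple tnth x (g i) | i < m].
Proof.
elim: phi => {m} [m t u|m t u|m s ts|m phi IH|m phi IHphi psi IHpsi|m phi IH] n g.
- by exists (Feq (rename_term g t) (rename_term g u)) => x /=; rewrite !eval_rename.
- by exists (Flt (rename_term g t) (rename_term g u)) => x /=; rewrite !eval_rename.
- exists (Frel (fun i => rename_term g (ts i))) => x /=.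
  by under eq_mktuple do rewrite eval_rename.
- by have [psi hpsi] := IH n g; exists (Fnot psi) => x /=; rewrite hpsi.
- have [phi' hphi] := IHphi n g; have [psi' hpsi] := IHpsi n g.
  by exists (Fand phi' psi') => x /=; rewrite hphi hpsi.
(* Under the quantifier the bound variable is last on both sides and must be sent to itself. *)
- pose g' (i : 'I_m.+1) : 'I_n.+1 :=
    if unlift ord_max i is Some j then lift ord_max (g j) else ord_max.
  have [psi hpsi] := IH _ g'; exists (Fexists psi) => x /=.
  suff eq_env y : [tuple tnth (rcons_tuple x y) (g' i) | i < m.+1] =
      rcons_tuple [tuple tnth x (g i) | i < m] y.
    by split => -[y sy]; exists y; move: sy; rewrite hpsi eq_env.
  apply: eq_from_tnth => i; rewrite tnth_mktuple /g'.
  case: unliftP => [j|] ->; last by rewrite !tnth_rcons_max.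
  by rewrite !tnth_rcons_lift tnth_mktuple.
Qed.

(** * Definability over a base tuple with quantified variables *)

Section Contexts.
Variable n : nat.

(** A context is an [n]-tuple together with [k] further variables, the last one
    of which is the one bound by the next quantifier. *)
Fixpoint ctx k : Type := if k is k'.+1 then (ctx k' * M)%type else n.-tuple M.

(** The length is [k + n] because [k.+1 + n] computes to [(k + n).+1], the form in [rcons_tuple] and
    [Fexists]. *)
Fixpoint enc k : ctx k -> (k + n).-tuple M :=
  match k with
  | 0 => fun z => z
  | k'.+1 => fun g => rcons_tuple (enc g.1) g.2
  end.

(** Predicates are functions of the context, so definability can be proved along their logical form
    without writing out a formula. *)
Definition ctx_definable k (Q : ctx k -> Prop) :=
  exists phi : formula L M (k + n), forall g, Q g <-> sat S phi (enc g).

(** Variables are kept apart from terms: [def_rel] instantiates a set by renaming variables, whereas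
    comparisons also accept parameters. *)
Definition ctx_var k (v : ctx k -> M) :=
  exists i, forall g, tnth (enc g) i = v g.

Definition ctx_term k (v : ctx k -> M) :=
  exists t, forall g, Defs.eval S (enc g) t = v g.

Definition ctx_vars k m (w : ctx k -> m.-tuple M) :=
  forall i, ctx_var (fun g => tnth (w g) i).

Fixpoint drop_vars j k : ctx (j + k) -> ctx k :=
  match j with
  | 0 => fun g => g
  | j'.+1 => fun g => @drop_vars j' k g.1
  end.

Fixpoint base_tuple k : ctx k -> n.-tuple M :=
  match k with
  | 0 => fun z => z
  | k'.+1 => fun g => base_tuple g.1
  end.

Lemma ctx_var_last k : ctx_var (fun g : ctx k.+1 => g.2).
Proof. by exists ord_max => g; rewrite /= tnth_rcons_max. Qed.

Lemma ctx_var_drop j k (v : ctx k -> M) :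
  ctx_var v -> ctx_var (fun g : ctx (j + k) => v (drop_vars g)).
Proof.
elim: j => [|j IH] // /IH[i hi]; exists (lift (ord_max : 'I_(j + k + n).+1) i) => g.
by rewrite /= tnth_rcons_lift hi.
Qed.

Lemma ctx_vars_drop j k m (w : ctx k -> m.-tuple M) :
  ctx_vars w -> ctx_vars (fun g : ctx (j + k) => w (drop_vars g)).
Proof. by move=> hw i; apply: ctx_var_drop (hw i). Qed.

Lemma ctx_vars_base k : ctx_vars (@base_tuple k).
Proof.
elim: k => [|k IH] i; first by exists i.
exact: (ctx_var_drop 1 (IH i)).
Qed.

Lemma ctx_vars_cons k m (v : ctx k -> M) (w : ctx k -> m.-tuple M) :
  ctx_var v -> ctx_vars w -> ctx_vars (fun g => cons_tuple (v g) (w g)).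
Proof.
move=> [j hj] hw i; case: (unliftP ord0 i) => [i'|] ->.
  by have [i0 hi0] := hw i'; exists i0 => g; rewrite tnthS.
by exists j.
Qed.

Lemma ctx_vars_rcons k m (v : ctx k -> M) (w : ctx k -> m.-tuple M) :
  ctx_var v -> ctx_vars w -> ctx_vars (fun g => rcons_tuple (w g) (v g)).
Proof.
move=> [j hj] hw i; case: (unliftP ord_max i) => [i'|] ->.
  by have [i0 hi0] := hw i'; exists i0 => g; rewrite tnth_rcons_lift.
by exists j => g; rewrite tnth_rcons_max.
Qed.

Lemma ctx_term_var k (v : ctx k -> M) : ctx_var v -> ctx_term v.
Proof. by move=> [i hi]; exists (Var _ _ i). Qed.

Lemma ctx_term_cst k c : ctx_term (fun _ : ctx k => c).
Proof. by exists (Cst _ _ c). Qed.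

Lemma ctx_term_weak k (v : ctx k -> M) :
  ctx_term v -> ctx_term (fun g : ctx k.+1 => v g.1).
Proof.
move=> [t ht]; exists (rename_term (lift ord_max) t : term L M (k + n).+1) => g.
rewrite -ht /= eval_rename; congr Defs.eval.
by apply: eq_from_tnth => i; rewrite tnth_mktuple tnth_rcons_lift.
Qed.

Lemma ctx_definable_ext k (Q R : ctx k -> Prop) :
  (forall g, Q g <-> R g) -> ctx_definable Q -> ctx_definable R.
Proof. by move=> QR [phi hphi]; exists phi => g; rewrite -QR. Qed.

Lemma def_not k (Q : ctx k -> Prop) : ctx_definable Q -> ctx_definable (fun g => ~ Q g).
Proof. by move=> [phi hphi]; exists (Fnot phi) => g /=; rewrite hphi. Qed.

Lemma def_and k (Q R : ctx k -> Prop) :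
  ctx_definable Q -> ctx_definable R -> ctx_definable (fun g => Q g /\ R g).
Proof.
by move=> [phi hphi] [psi hpsi]; exists (Fand phi psi) => g /=; rewrite hphi hpsi.
Qed.

Lemma def_imp k (Q R : ctx k -> Prop) :
  ctx_definable Q -> ctx_definable R -> ctx_definable (fun g => Q g -> R g).
Proof.
move=> hQ hR; apply: ctx_definable_ext (def_not (def_and hQ (def_not hR))) => g.
split => [nQR Qg|QR [/QR Rg] //].
by apply: contrapT => nR; apply: nQR.
Qed.

Lemma def_ex k (R : ctx k -> M -> Prop) :
  ctx_definable (fun g : ctx k.+1 => R g.1 g.2) ->
  ctx_definable (fun g => exists y, R g y).
Proof.
move=> [phi hphi]; exists (Fexists phi) => g /=.
by split => -[y hy]; exists y; [exact: (proj1 (hphi (g, y)) hy)|exact: (proj2 (hphi (g, y)) hy)].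
Qed.

Lemma def_all k (R : ctx k -> M -> Prop) :
  ctx_definable (fun g : ctx k.+1 => R g.1 g.2) ->
  ctx_definable (fun g => forall y, R g y).
Proof.
move=> hR; apply: ctx_definable_ext (def_not (def_ex (R := fun g y => ~ R g y) (def_not hR))) => g.
split => [nR y|Rg [y ny]]; last exact: ny (Rg y).
by apply: contrapT => nRy; apply: nR; exists y.
Qed.

Lemma def_ex2 k (Q R : ctx k -> M -> Prop) :
  ctx_definable (fun g : ctx k.+1 => Q g.1 g.2) ->
  ctx_definable (fun g : ctx k.+1 => R g.1 g.2) ->
  ctx_definable (fun g => exists2 y, Q g y & R g y).
Proof.
move=> hQ hR; have := def_ex (R := fun g y => Q g y /\ R g y) (def_and hQ hR).
by apply: ctx_definable_ext => g; split => [[y []]|[y]]; exists y.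
Qed.

Lemma def_lt k (v w : ctx k -> M) : ctx_term v -> ctx_term w ->
  ctx_definable (fun g => (v g < w g)%O).
Proof. by move=> [t ht] [u hu]; exists (Flt t u) => g /=; rewrite ht hu. Qed.

Lemma def_le k (v w : ctx k -> M) : ctx_term v -> ctx_term w ->
  ctx_definable (fun g => (v g <= w g)%O).
Proof.
move=> hv hw; apply: ctx_definable_ext (def_not (def_lt hw hv)) => g.
by rewrite leNgt; split => /negP.
Qed.

Lemma def_andb k (Q R : ctx k -> bool) :
  ctx_definable (fun g => Q g) -> ctx_definable (fun g => R g) ->
  ctx_definable (fun g => Q g && R g).
Proof.
by move=> hQ hR; apply: ctx_definable_ext (def_and hQ hR) => g; split => /andP.
Qed.

Lemma def_rel k m (X : set (m.-tuple M)) (w : ctx k -> m.-tuple M) :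
  definable S X -> ctx_vars w -> ctx_definable (fun g => X (w g)).
Proof.
move=> [phi ->] /choice[h hh]; have [psi hpsi] := rename_formula phi h.
exists psi => g; rewrite hpsi /=.
suff -> : [tuple tnth (enc g) (h i) | i < m] = w g by [].
by apply: eq_from_tnth => i; rewrite tnth_mktuple hh.
Qed.

Lemma def_rel1 k (X : set M) (v : ctx k -> M) :
  definable1 S X -> ctx_var v -> ctx_definable (fun g => X (v g)).
Proof.
move=> hX hv; apply: (def_rel (w := fun g => [tuple v g]) hX).
by move=> i; case: hv => j hj; exists j => g; rewrite hj ord1.
Qed.

(** The truth value of [p] is coded by [c = c] or its negation; [c] supplies the point that these
    formulas mention. *)
Lemma def_const (c : M) k (p : Prop) : ctx_definable (fun _ : ctx k => p).
Proof.
have [hp|np] := pselect p.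
  by exists (Feq (Cst _ _ c) (Cst _ _ c)).
by exists (Fnot (Feq (Cst _ _ c) (Cst _ _ c))) => g; split => // /(_ erefl).
Qed.

Lemma def_forall_ord (c : M) k m (Q : 'I_m -> ctx k -> Prop) :
  (forall i, ctx_definable (Q i)) -> ctx_definable (fun g => forall i, Q i g).
Proof.
elim: m Q => [|m IH] Q hQ.
  by apply: (ctx_definable_ext (Q := fun=> True)); [split => // _ []|exact: def_const].
apply: ctx_definable_ext (def_and (hQ ord0) (IH _ (fun i => hQ (lift ord0 i)))) => g.
split => [[Q0 QS] i|hg]; last by split => // i; apply: hg.
by case: (unliftP ord0 i) => [j|] ->.
Qed.

Lemma def_itv (c : M) k (v : ctx k -> M) (I : interval M) :
  ctx_var v -> ctx_definable (fun g => v g \in I).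
Proof.
move=> /ctx_term_var hv; case: I => a b.
have def_left : ctx_definable (fun g => (a <= BLeft (v g))%O).
  case: a => [[] s|e]; last exact: (def_const c _ (BInfty M e <= -oo)%O).
    exact: (def_le (ctx_term_cst _ s) hv).
  exact: (def_lt (ctx_term_cst _ s) hv).
have def_right : ctx_definable (fun g => (BRight (v g) <= b)%O).
  case: b => [[] s|e]; last exact: (def_const c _ (+oo <= BInfty M e)%O).
    exact: (def_lt hv (ctx_term_cst _ s)).
  exact: (def_le hv (ctx_term_cst _ s)).
exact: (def_andb def_left def_right).
Qed.

(** Sets of tuples [(x, z)] with [z] an [n]-tuple: the encoding of contexts puts [x] last. *)
Lemma definable_cons (Q : ctx 1 -> Prop) : ctx_definable Q ->
  definable S [set w : n.+1.-tuple M | exists x z, Q (z, x) /\ w = cons_tuple x z].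
Proof.
move=> [phi hphi].
pose g (i : 'I_(1 + n)) : 'I_n.+1 :=
  if unlift (ord_max : 'I_n.+1) i is Some j then lift ord0 j else ord0.
have [psi hpsi] := rename_formula phi g; exists psi; apply/seteqP.
have eq_env x (z : n.-tuple M) :
    [tuple tnth (cons_tuple x z) (g i) | i < 1 + n] = rcons_tuple z x.
  apply: eq_from_tnth => i; rewrite tnth_mktuple /g.
  by case: unliftP => [j|] ->; rewrite ?tnthS ?tnth_rcons_lift ?tnth_rcons_max.
split => [w [x [z [/hphi sxz ->]]]|w /=]; first by rewrite /= hpsi eq_env.
have w_eta : w = cons_tuple (thead w) (behead_tuple w) by exact: tuple_eta.
rewrite hpsi {1}w_eta eq_env => sw; exists (thead w), (behead_tuple w); split => //.
exact: (proj2 (hphi (behead_tuple w, thead w)) sw).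
Qed.

End Contexts.
End Definability.

(** * Automatic proofs of definability *)

Ltac drop_var j := first
  [ exact: (@ctx_var_drop _ _ _ j _ _ (@ctx_var_last _ _ _ _)) | exact: (@ctx_vars_base _ _ _ j)
  | match goal with
    | H : ctx_var _ |- _ => exact: (@ctx_var_drop _ _ _ j _ _ H)
    | H : ctx_vars _ |- _ => exact: (@ctx_vars_drop _ _ _ j _ _ _ H)
    end ].

(** Depth five is reached by the base tuple in the families of the record argument: three variables
    and two nested quantifiers. *)
Ltac solve_var := first
  [ drop_var 0 | drop_var 1 | drop_var 2 | drop_var 3 | drop_var 4 | drop_var 5 ].

Ltac definability := repeat first
  [ solve_var | apply: def_ex2 | apply: def_ex | apply: def_all
  | apply: def_and | apply: def_not | apply: def_imp | apply: def_andb | apply: def_lt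
  | apply: def_le | apply: ctx_term_var
  | match goal with H : context [ctx_definable] |- _ => apply: H end ].

(** * Upper bounds in the completion, and uniform tameness *)

Section Completion.
Context {L : language} {d : Order.disp_t} {M : orderTopologicalType d}.
Variable S : structure L M.
Implicit Types (s t : completion S) (x y b c : M).

(** A point of the completion is handled through its upper set in [M], which turns order and
    equality in the completion into statements about [M]. *)
Definition upper_bounds s : set M := [set c | cle s (Pt S c)].

Lemma upper_bounds_Pt x c : upper_bounds (Pt S x) c <-> (x <= c)%O.
Proof.
rewrite /upper_bounds /= /cle /= le_eqVlt; split => [[[->]|->]|/orP[/eqP->|]].
- by rewrite eqxx.
- by rewrite orbT.
- by left.
- by right.
Qed.

Lemma upper_bounds_GapPt g c : upper_bounds (GapPt g) c <-> ghigh g c.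
Proof. by split => [[//|]|] //; right. Qed.

Lemma glowE (g : gap S) x : glow g x <-> ~ ghigh g x.
Proof.
split => [lx hx|nh]; first by have := gap_lt lx hx; rewrite ltxx.
by have : [set: M] x by []; rewrite -(gap_cover g) => -[].
Qed.

Lemma upper_bounds_le s b c : (b <= c)%O -> upper_bounds s b -> upper_bounds s c.
Proof.
case: s => [x|g] bc; first by rewrite !upper_bounds_Pt => /le_trans; apply.
rewrite !upper_bounds_GapPt => hb; apply: contrapT => /glowE lc.
by have := gap_lt lc hb; rewrite ltNge bc.
Qed.

Lemma clt_PtlE b s : clt (Pt S b) s <-> ~ upper_bounds s b.
Proof.
case: s => [x|g] /=; last by rewrite upper_bounds_GapPt glowE.
by rewrite upper_bounds_Pt ltNge; split => /negP.
Qed.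

(** For a point [x] the bound below [b] is [x] itself; for a gap it exists because [ghigh] has no
    least element. *)
Lemma clt_PtrE b s : clt s (Pt S b) <-> exists2 c, (c < b)%O & upper_bounds s c.
Proof.
case: s => [x|g] /=.
  split => [xb|[c cb /upper_bounds_Pt xc]]; last exact: le_lt_trans cb.
  by exists x => //; apply/upper_bounds_Pt.
split => [hb|[c cb /upper_bounds_GapPt hc]]; last first.
  by apply/upper_bounds_GapPt/(upper_bounds_le (ltW cb))/upper_bounds_GapPt.
apply: contrapT => nc; apply: (@ghigh_nomin _ _ _ _ g); exists b => // y hy.
rewrite leNgt; apply/negP => yb; apply: nc; exists y => //.
exact/upper_bounds_GapPt.
Qed.

(** Upper sets are nested, and that of the larger point is strictly smaller; the witness in [M]
    makes comparison of values definable. *)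
Lemma cltE s t : clt s t <-> exists c, upper_bounds s c /\ ~ upper_bounds t c.
Proof.
case: s => [x|g].
  rewrite clt_PtlE; split => [nx|[c [/upper_bounds_Pt xc nc]] hx].
    by exists x; split => //; apply/upper_bounds_Pt.
  by apply: nc; apply: upper_bounds_le hx.
case: t => [y|h].
  rewrite clt_PtrE; split => [[c cy hc]|[c [hc nc]]]; exists c => //.
    by split => //; rewrite upper_bounds_Pt leNgt cy.
  by rewrite ltNge; apply/negP => yc; apply: nc; apply/upper_bounds_Pt.
rewrite /=; split => [[_ /nonsubset[c [hc lc]]]|[c [/upper_bounds_GapPt gc nc]]].
  exists c; split; last by rewrite upper_bounds_GapPt -glowE.
  by apply/upper_bounds_GapPt; apply: contrapT => /glowE.
have hc : glow h c by rewrite glowE -upper_bounds_GapPt.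
split; last by move=> /(_ c hc); rewrite glowE.
move=> x lx; apply/glowE => hx; apply/nc.
apply: (upper_bounds_le (ltW (gap_lt lx gc))); exact/upper_bounds_GapPt.
Qed.

(** A point is the least of its upper bounds, while [ghigh] has no least element, so a point and a
    gap differ. Two gaps with the same cut agree by proof irrelevance. *)
Lemma upper_bounds_inj s t : (forall c, upper_bounds s c <-> upper_bounds t c) -> s = t.
Proof.
case: s => [x|g]; case: t => [y|h] => hst.
- congr Pt; apply/le_anti/andP; split; first by apply/upper_bounds_Pt/hst/upper_bounds_Pt.
  by apply/upper_bounds_Pt/hst/upper_bounds_Pt.
- exfalso; apply: (@ghigh_nomin _ _ _ _ h); exists x.
    by apply/upper_bounds_GapPt/hst/upper_bounds_Pt.
  by move=> y /upper_bounds_GapPt/hst/upper_bounds_Pt.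
- exfalso; apply: (@ghigh_nomin _ _ _ _ g); exists y.
    by apply/upper_bounds_GapPt/hst/upper_bounds_Pt.
  by move=> x /upper_bounds_GapPt/hst/upper_bounds_Pt.
- congr GapPt.
  have high_eq : ghigh g = ghigh h.
    by apply/seteqP; split => c /upper_bounds_GapPt/hst/upper_bounds_GapPt.
  have low_eq : glow g = glow h.
    by apply/seteqP; split => c; rewrite !glowE high_eq.
  case: g h high_eq low_eq {hst} => gl gh ? ? ? ? ? ? ? ? [hl hh ? ? ? ? ? ? ? ?] /= eh el.
  by subst; congr Gap; exact: Prop_irrelevance.
Qed.

(** Comparison with a supremum is expressed without the completion; this is how definability of [Y]
    passes to [f]. *)
Lemma is_sup_upper_bounds (Y : set M) s c :
  is_sup Y s -> upper_bounds s c <-> forall y, Y y -> (y <= c)%O.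
Proof.
move=> [ub lub]; split => [sc y /ub[eq_s|/clt_PtlE ny]|hc].
- by move: sc; rewrite -eq_s => /upper_bounds_Pt.
- by rewrite leNgt; apply/negP => cy; apply: ny; apply: upper_bounds_le (ltW cy) sc.
- by apply: lub => y /hc yc; apply/upper_bounds_Pt.
Qed.
End Completion.

(** * Uniform tameness in definable families *)

Section Uniform.
Context {L : language} {d : Order.disp_t} {M : orderTopologicalType d}.
Variable S : structure L M.
Hypothesis dlo : dlo_without_endpoints M.
Variable n : nat.
(** [V] consists of the neighbourhoods of a point for structures of the second kind,
    and of the whole space alone for those of the first kind. *)
Definition uniform_over (V : set (set (n.-tuple M))) :=
  forall Q : ctx n 3 -> Prop, ctx_definable S Q -> forall a q : M,
  exists l v l' v' Z, [/\ (l < a < v)%O, (l' < q < v')%O, V Z &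
    forall z x x', Z z -> (l' < x < v')%O -> (l' < x' < v')%O ->
      tame ([set y | Q (z, x, x', y)] `&` [set` `]l, v[%O])].

Lemma uniform_over1 : unif_locally_weakly_ominimal1 S -> uniform_over [set setT].
Proof.
move=> [_ hS] Q [phi hphi] a q.
(* The two extra variables make the number of parameters positive even when [n = 0]. *)
have [|I aI hI] := hS (2 + n)%N [set w | sat S phi w] a isT; first by exists phi.
have [l [v [lav sI]]] := open_ends_itv dlo aI.
have [_ /(_ q)[l' l'q] /(_ q)[v' qv']] := dlo.
exists l, v, l', v', setT; split => //; first by rewrite l'q.
move=> z x x' _ _ _.
apply: (@tame_sub_itv _ _ _ _ I) => //.
have := hI (enc (k := 2) (z, x, x')); congr (tame (_ `&` _)).
by apply/seteqP; split => y; rewrite /fiber /= => /(hphi (z, x, x', y)).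
Qed.

Definition box_nbhs (p : n.-tuple M) : set (set (n.-tuple M)) :=
  [set Z | exists lo hi : 'I_n -> M, (forall i, lo i < tnth p i < hi i)%O /\
     forall z, (forall i, lo i < tnth z i < hi i)%O -> Z z].

Lemma box_nbhsI p Z1 Z2 : box_nbhs p Z1 -> box_nbhs p Z2 -> box_nbhs p (Z1 `&` Z2).
Proof.
move=> [lo1 [hi1 [h1 sub1]]] [lo2 [hi2 [h2 sub2]]].
exists (fun i => Order.max (lo1 i) (lo2 i)), (fun i => Order.min (hi1 i) (hi2 i)).
split => [i|z hz].
  by have /andP[? ?] := h1 i; have /andP[? ?] := h2 i; rewrite gt_max lt_min; apply/andP; split; apply/andP.
split; [apply: sub1|apply: sub2] => i; have := hz i; rewrite gt_max lt_min.
  by move=> /andP[/andP[-> _] /andP[->]].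
by move=> /andP[/andP[_ ->] /andP[_ ->]].
Qed.

Lemma uniform_over2 p : unif_locally_weakly_ominimal2 S -> uniform_over (box_nbhs p).
Proof.
move=> [_ hS] Q [phi hphi] a q.
have [|I [B [aI bB hI]]] := hS (2 + n)%N [set w | sat S phi w] a (enc (k := 2) (p, q, q)) isT.
  by exists phi.
have [l [v [lav sI]]] := open_ends_itv dlo aI.
have /choice[lo /choice[hi hB]] i := open_ends_itv dlo (bB i).
pose i2 : 'I_(2 + n) := ord_max; pose j1 : 'I_(1 + n) := ord_max.
pose i1 : 'I_(2 + n) := lift i2 j1; pose i0 (i : 'I_n) : 'I_(2 + n) := lift i2 (lift j1 i).
have enc2 (z : n.-tuple M) x x' : [/\ tnth (enc (k := 2) (z, x, x')) i2 = x',
    tnth (enc (k := 2) (z, x, x')) i1 = x & forall i, tnth (enc (k := 2) (z, x, x')) (i0 i) = tnth z i].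
  by split => [||i]; rewrite /= ?tnth_rcons_lift ?tnth_rcons_max // ?tnth_rcons_lift.
have [e2 e1 e0] := enc2 p q q.
have [+ _] := hB i2; have [+ _] := hB i1; rewrite e1 e2 => /andP[lq1 qh1] /andP[lq2 qh2].
(* Both [x] and [x'] are to range over one interval, so the sides of the box at [i1] and [i2] are
   intersected. *)
exists l, v, (Order.max (lo i1) (lo i2)), (Order.min (hi i1) (hi i2)).
exists [set z | forall i, lo (i0 i) < tnth z i < hi (i0 i)]%O; split => //.
- by rewrite gt_max lt_min lq1 lq2 qh1.
- exists (lo \o i0), (hi \o i0); split => // i.
  by have [+ _] := hB (i0 i); rewrite e0.
move=> z x x' hz; rewrite !gt_max !lt_min.
move=> /andP[/andP[x1 x2] /andP[x3 x4]] /andP[/andP[y1 y2] /andP[y3 y4]].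
apply: (@tame_sub_itv _ _ _ _ I) => //.
have : box B (enc (k := 2) (z, x, x')).
  have [f2 f1 f0] := enc2 z x x'.
  move=> i; have [_ sB] := hB i; apply: sB.
  case: (unliftP i2 i) => [j|] ->; last by rewrite f2 y2 y4.
  case: (unliftP j1 j) => [i'|] ->; first by rewrite [tnth _ _]f0; exact: hz.
  by rewrite f1 x1 x3.
move=> /hI; congr (tame (_ `&` _)).
by apply/seteqP; split => y; rewrite /fiber /= => /(hphi (z, x, x', y)).
Qed.

End Uniform.

(** * The partition *)

Section Monotonicity.
Context {L : language} {d : Order.disp_t} {M : orderTopologicalType d}.
Variable S : structure L M.
Hypothesis dlo : dlo_without_endpoints M.
Variable n : nat.
Variables (V : set (set (n.-tuple M))).
Hypothesis VI : forall Z Z', V Z -> V Z' -> V (Z `&` Z').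
Hypothesis unifV : uniform_over S V.
Implicit Types (z : n.-tuple M) (l v x y : M).

Definition family := n.-tuple M -> M -> M -> Prop.

Definition family_definable (Q : family) :=
  ctx_definable S (fun g : ctx n 3 => Q g.1.1.1 g.1.1.2 g.2).

Definition family_tame l v (Z : set (n.-tuple M)) (Q : family) :=
  forall z x, Z z -> l < x < v -> tame (Q z x `&` [set` `]l, v[%O]).

(** The parameter [x] and the points of the sets end up in one interval around [a], as the record
    argument requires. *)
Lemma families_tame (a : M) m (Q : 'I_m -> family) :
  (forall i, family_definable (Q i)) ->
  exists l v Z, [/\ l < a < v, V Z & forall i, family_tame l v Z (Q i)].
Proof.
elim: m Q => [|m IH] Q hQ.
  have [l [v [_ [_ [Z [lav _ VZ _]]]]]] := unifV (def_const S n a 3 True) a a.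
  by exists l, v, Z; split => // -[].
have [l1 [v1 [Z1 [/andP[la1 av1] VZ1 h1]]]] := IH _ (fun i => hQ (lift ord0 i)).
have [l2 [v2 [l3 [v3 [Z2 [/andP[la2 av2] /andP[la3 av3] VZ2 h2]]]]]] := unifV (hQ ord0) a a.
(* Here [l2] and [v2] bound the points of the new family, [l3] and [v3] its parameter. *)
exists (Order.max l1 (Order.max l2 l3)), (Order.min v1 (Order.min v2 v3)), (Z1 `&` Z2).
split; [by rewrite !gt_max !lt_min la1 la2 la3 av1 av2|exact: VI|].
move=> i z x [Z1z Z2z]; rewrite !gt_max !lt_min => /andP[/and3P[l1x l2x l3x] /and3P[xv1 xv2 xv3]].
case: (unliftP ord0 i) => [j|] ->.
  apply: (@tame_sub_itv _ _ _ _ `]l1, v1[%O) => //; last by apply: h1 => //; rewrite l1x.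
  by rewrite !itv_ooE => y /=; rewrite !gt_max !lt_min => /andP[/andP[-> _] /andP[->]].
apply: (@tame_sub_itv _ _ _ _ `]l2, v2[%O) => //; last by apply: (h2 z x x); rewrite ?l3x.
rewrite !itv_ooE => y /=; rewrite !gt_max !lt_min.
by move=> /andP[/and3P[_ -> _] /and3P[_ ->]].
Qed.

Section Family.
Variable lt : n.-tuple M -> M -> M -> Prop.
Hypothesis lt_trans_ : forall z x y w, lt z x y -> lt z y w -> lt z x w.
Hypothesis nlt_trans : forall z x y w, ~ lt z x y -> ~ lt z y w -> ~ lt z x w.
Hypothesis def_rel_lt : forall k (z : ctx n k -> n.-tuple M) (x y : ctx n k -> M),
  ctx_vars z -> ctx_var x -> ctx_var y -> ctx_definable S (fun g => lt (z g) (x g) (y g)).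

(** [Some true] codes increasing, [Some false] decreasing and [None] constant, equality of values
    being incomparability. *)
Definition dir_rel (s : option bool) z x y :=
  match s with
  | Some true => lt z x y
  | Some false => lt z y x
  | None => ~ lt z x y /\ ~ lt z y x
  end.

Definition locally_mono s z : set M :=
  [set x | exists l v, l < x < v /\ mono_itv (dir_rel s z) l v].

Definition nowhere_mono z : set M := [set x | forall s, ~ locally_mono s z x].

Lemma def_dir_rel s k (z : ctx n k -> n.-tuple M) (x y : ctx n k -> M) :
  ctx_vars z -> ctx_var x -> ctx_var y ->
  ctx_definable S (fun g => dir_rel s (z g) (x g) (y g)).
Proof. by move=> hz hx hy; case: s => [[]|] /=; definability. Qed.

Lemma def_locally_mono s k (z : ctx n k -> n.-tuple M) (x : ctx n k -> M) :
  ctx_vars z -> ctx_var x -> ctx_definable S (fun g => locally_mono s (z g) (x g)).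
Proof.
move=> hz hx; rewrite /locally_mono /mono_itv /mkset.
by do 2!apply: def_ex; case: s => [[]|] /=; definability.
Qed.

(** The four sets required by [exists_mono_itv], in the order of its hypotheses. *)
Definition family_of (j : 'I_4) (s : bool) : family := fun z x =>
  let r := dir_rel (Some s) z in
  match val j with
  | 0 => [set y | r y x]
  | 1 => [set x | exists2 t, t < x & forall y, t < y < x -> r y x]
  | 2 => left_record r x
  | _ => left_children r x
  end.

Lemma def_family_of j s : family_definable (family_of j s).
Proof.
rewrite /family_definable /family_of; case: j => [[|[|[|j]]] hj] /=; rewrite /left_children /left_record /mkset.
- case: s; definability.
- case: s; definability.
- case: s; definability.
- case: s; definability.
Qed.

(** The set [nowhere_mono z] is tame, so if infinite it contains an interval, on which
    [exists_mono_itv] finds a monotone subinterval: a contradiction. *)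
Lemma lt_family_tame a : exists l v Z, [/\ l < a < v, V Z &
  forall z, Z z -> (forall s, tame (locally_mono s z `&` [set` `]l, v[%O])) /\
    finite_set (nowhere_mono z `&` [set` `]l, v[%O])].
Proof.
(* One finite index type collects all the families, so that a single interval and a single [Z] serve
   them all. *)
pose Q (i : 'I_4 * bool + option bool + unit) : family :=
  match i with
  | inl (inl (j, s)) => family_of j s
  | inl (inr s) => fun z _ => locally_mono s z
  | inr _ => fun z _ => nowhere_mono z
  end.
have [i|l [v [Z [lav VZ hQ]]]] :=
    families_tame a (Q := fun i : 'I_#|{: 'I_4 * bool + option bool + unit}| => Q (enum_val i)).
  case: (enum_val i) => [[[j s]|s]|[]]; first exact: def_family_of.
    by apply: def_locally_mono; solve_var.
  (* The quantifier over [s] does not range over [M], so its three cases are written out. *)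
  apply: (ctx_definable_ext (Q := fun g : ctx n 3 => ~ locally_mono (Some true) g.1.1.1 g.2 /\
     ~ locally_mono (Some false) g.1.1.1 g.2 /\ ~ locally_mono None g.1.1.1 g.2)).
    move=> g; split => [[? [? ?]]|h]; first by case=> [[]|].
    by split; [|split]; apply: h.
  by apply: def_and; [|apply: def_and]; apply: def_not; apply: def_locally_mono; solve_var.
have {}hQ i : family_tame l v Z (Q i) by have := hQ (enum_rank i); rewrite enum_rankK.
exists l, v, Z; split => // z Zz.
split => [s|]; first exact: (hQ (inl (inr s)) z a).
have [//|[l1 [v1 [lv1 sub1]]]] := tame_finite_or_itv (hQ (inr tt) z a Zz lav).
have {sub1} [non1 sub1] : (forall x, l1 < x < v1 -> nowhere_mono z x) /\ (forall x, l1 < x < v1 -> l < x < v).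
  by rewrite itv_ooE in sub1; split => x /sub1[].
have dec i s x : l1 < x < v1 -> left_decided (family_of i s z x) x.
  move=> /sub1 lxv; apply: (@tame_left_decided _ _ _ _ `]l, v[%O) => //.
  exact: (hQ (inl (inl (i, s)))).
have [|l2 [v2 [l12 lv2 v21 hmono]]] :=
    @exists_mono_itv _ _ dlo (lt z) l1 v1 lv1 (@lt_trans_ z) (@nlt_trans z).
  move=> s r; split => [x lxv|x lxv|c l2 v2 lcv l12 v21|x lxv].
  - exact: (dec (@Ordinal 4 0 isT) s x lxv).
  - exact: (dec (@Ordinal 4 1 isT) s x lxv).
  - rewrite -itv_ooE; apply/tame_finite_or_itv/(@tame_sub_itv _ _ _ _ `]l, v[%O) => //; last first.
      exact: (hQ (inl (inl (@Ordinal 4 2 isT, s))) z c Zz (sub1 _ lcv)).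
    rewrite !itv_ooE => y /andP[l2y yv2]; apply: sub1.
    by rewrite (le_lt_trans l12) // (lt_le_trans yv2).
  - exact: (dec (@Ordinal 4 3 isT) s x lxv).
have [m /andP[l2m mv2]] : exists m, l2 < m < v2 by case: dlo => + _ _; apply.
have l1m : l1 < m < v1 by rewrite (le_lt_trans l12) ?(lt_le_trans mv2).
exfalso; case: hmono => hmono.
- by apply: (non1 m l1m (Some true)); exists l2, v2; rewrite l2m.
- by apply: (non1 m l1m (Some false)); exists l2, v2; rewrite l2m.
- by apply: (non1 m l1m None); exists l2, v2; rewrite l2m.
Qed.
End Family.
End Monotonicity.

(** * Partition of the preimage by type of monotonicity *)

Section Partition.
Context {L : language} {d : Order.disp_t} {M : orderTopologicalType d}.
Variable S : structure L M.
Hypothesis dlo : dlo_without_endpoints M.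
Variable n : nat.
Variables (A : set M) (P : set (n.-tuple M)) (f : n.+1.-tuple M -> completion S).
Hypotheses (hA : definable1 S A) (hP : definable S P).
Hypothesis hf : definable_fun (prodset A P) f.
Implicit Types (z : n.-tuple M) (l v x y c : M) (I J : interval M).

Lemma prodsetE x z : prodset A P (cons_tuple x z) <-> A x /\ P z.
Proof.
split => [[x' [z' [Ax Pz /(congr1 val)[-> /val_inj ->]]]]|[Ax Pz]] //.
by exists x, z.
Qed.

(** [f (x, z) <= c], in a form that makes sense and is definable for all [x] and [z]. *)
Lemma definable_fun_upper_bounds : exists ub : n.-tuple M -> M -> M -> Prop,
  [/\ forall z x c c', c <= c' -> ub z x c -> ub z x c',
      forall z x c, A x -> P z -> upper_bounds (f (cons_tuple x z)) c <-> ub z x c &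
      forall k (z : ctx n k -> n.-tuple M) (x c : ctx n k -> M),
        ctx_vars z -> ctx_var x -> ctx_term S c ->
        ctx_definable S (fun g => ub (z g) (x g) (c g))].
Proof.
have [Y [hY _ supY]] := hf.
exists (fun z x c => forall v, Y (rcons_tuple (cons_tuple x z) v) -> v <= c); split.
- by move=> z x c c' cc' h v /h/le_trans; apply.
- move=> z x c Ax Pz; apply: is_sup_upper_bounds; apply: supY; exact/prodsetE.
- move=> k z x c hz hx hc; apply: def_all; apply: def_imp.
    apply: (def_rel hY); apply: ctx_vars_rcons; first by solve_var.
    by apply: ctx_vars_cons; solve_var.
  apply: def_le; first by apply: ctx_term_var; solve_var.
  exact: (ctx_term_weak hc).
Qed.

Section UpperBounds.
Variable ub : n.-tuple M -> M -> M -> Prop.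
Hypothesis ub_le : forall z x c c', c <= c' -> ub z x c -> ub z x c'.
Hypothesis ubE : forall z x c, A x -> P z -> upper_bounds (f (cons_tuple x z)) c <-> ub z x c.
Hypothesis def_ub : forall k (z : ctx n k -> n.-tuple M) (x c : ctx n k -> M),
  ctx_vars z -> ctx_var x -> ctx_term S c -> ctx_definable S (fun g => ub (z g) (x g) (c g)).

(** By [cltE] this is [f (x, z) < f (y, z)] where [f] is defined; in this form it is definable for
    all [x], [y] and [z]. *)
Let lt z x y := exists c, ub z x c /\ ~ ub z y c.

Lemma lt_trans_ub z x y w : lt z x y -> lt z y w -> lt z x w.
Proof.
move=> [c [xc nyc]] [c' [yc' nwc']]; exists c'; split => //; apply: ub_le xc.
by rewrite leNgt; apply/negP => /ltW/ub_le/(_ yc').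
Qed.

(** The negation of [lt z x y] is the inclusion of [ub z x] in [ub z y], and inclusions compose. *)
Lemma nlt_trans_ub z x y w : ~ lt z x y -> ~ lt z y w -> ~ lt z x w.
Proof.
move=> nxy nyw [c [xc nwc]]; apply: nyw; exists c; split => //.
by apply: contrapT => nyc; apply: nxy; exists c.
Qed.

Lemma lt_clt z x y : P z -> A x -> A y ->
  lt z x y <-> clt (f (cons_tuple x z)) (f (cons_tuple y z)).
Proof.
move=> Pz Ax Ay; rewrite cltE.
by split => -[c [h1 h2]]; exists c; move: h1 h2; rewrite !ubE.
Qed.

Lemma nlt_eq z x y : P z -> A x -> A y -> ~ lt z x y -> ~ lt z y x ->
  f (cons_tuple x z) = f (cons_tuple y z).
Proof.
move=> Pz Ax Ay nxy nyx; apply: upper_bounds_inj => c; rewrite !ubE //.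
by split => h; apply: contrapT => nh; [apply: nxy|apply: nyx]; exists c.
Qed.

Lemma def_lt_ub k (z : ctx n k -> n.-tuple M) (x y : ctx n k -> M) :
  ctx_vars z -> ctx_var x -> ctx_var y -> ctx_definable S (fun g => lt (z g) (x g) (y g)).
Proof.
move=> hz hx hy; apply: def_ex; apply: def_and; last apply: def_not;
  apply: def_ub; try apply: ctx_term_var; solve_var.
Qed.

(** [preim_bar A P f J], with [f (x, z)] accessed only through its upper bounds. *)
Definition preim_ub J z x : Prop :=
  [/\ A x, P z & match J with Interval a b =>
     match a with BSide _ b1 => ~ ub z x b1 | BInfty e => e end /\
     match b with BSide _ b2 => exists2 c, c < b2 & ub z x c | BInfty e => ~~ e end end].

Lemma preim_ubE J z x : preim_bar A P f J (cons_tuple x z) <-> preim_ub J z x.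
Proof.
rewrite /preim_ub /preim_bar /setI /preimage /mkset.
rewrite prodsetE; suff hJ : A x -> P z -> itv_bar J (f (cons_tuple x z)) <->
    match J with Interval a b =>
     match a with BSide _ b1 => ~ ub z x b1 | BInfty e => e end /\
     match b with BSide _ b2 => exists2 c, c < b2 & ub z x c | BInfty e => ~~ e end end.
  by split => [[[Ax Pz] /(hJ Ax Pz)]|[Ax Pz /(hJ Ax Pz)]].
move=> Ax Pz.
have hl b : clt (Pt S b) (f (cons_tuple x z)) <-> ~ ub z x b by rewrite clt_PtlE ubE.
have hr b : clt (f (cons_tuple x z)) (Pt S b) <-> exists2 c, c < b & ub z x c.
  by rewrite clt_PtrE; split => -[c cb hc]; exists c => //; move: hc; rewrite ubE.
by case: J => [[? b1|e1] [? b2|e2]]; rewrite /itv_bar /mkset ?hl ?hr.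
Qed.

Lemma def_preim_ub (m0 : M) J k (z : ctx n k -> n.-tuple M) (x : ctx n k -> M) :
  ctx_vars z -> ctx_var x -> ctx_definable S (fun g => preim_ub J (z g) (x g)).
Proof.
move=> hz hx; pose R1 (b : itv_bound M) z x := match b with BSide _ b1 => ~ ub z x b1 | BInfty e => e end.
pose R2 (b : itv_bound M) z x := match b with BSide _ b2 => exists2 c, c < b2 & ub z x c | BInfty e => ~~ e end.
case: J => a b.
apply: (ctx_definable_ext (Q := fun g => A (x g) /\ P (z g) /\ R1 a (z g) (x g) /\ R2 b (z g) (x g))).
  by move=> g; split => [[? [? ?]]|[? ? ?]]; split.
apply: def_and; first exact: def_rel1.
apply: def_and; first exact: def_rel.
apply: def_and.
  case: a => [e c|e] /=; last exact: (def_const S n m0).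
  by apply/def_not/def_ub => //; exact: ctx_term_cst.
case: b => [e c|e] /=; last exact: (def_const S n m0).
apply: def_ex2.
  by apply: def_lt; [apply/ctx_term_var; solve_var|exact: ctx_term_cst].
by apply: def_ub; [solve_var|solve_var|apply: ctx_term_var; solve_var].
Qed.

(** The endpoints are variables here, which later gives tameness uniformly over all small [J]. *)
Lemma def_preim_ub_oo k (z : ctx n k -> n.-tuple M) (x b1 b2 : ctx n k -> M) :
  ctx_vars z -> ctx_var x -> ctx_var b1 -> ctx_var b2 ->
  ctx_definable S (fun g => preim_ub `]b1 g, b2 g[%O (z g) (x g)).
Proof.
move=> hz hx h1 h2.
apply: (ctx_definable_ext (Q := fun g => A (x g) /\ P (z g) /\ ~ ub (z g) (x g) (b1 g) /\
    exists2 c, c < b2 g & ub (z g) (x g) c)).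
  by move=> g; split => [[? [? ?]]|[? ? ?]]; split.
apply: def_and; first exact: def_rel1.
apply: def_and; first exact: def_rel.
apply: def_and; first by apply/def_not/def_ub => //; exact: ctx_term_var.
apply: def_ex2; first by apply: def_lt; apply: ctx_term_var; solve_var.
by apply: def_ub; [solve_var|solve_var|apply: ctx_term_var; solve_var].
Qed.

Section Piece.
Variables (I J : interval M).

(** Taking the interior makes the piece open and loses only finitely many points, which go to
    [remainder]. *)
Definition piece s z : set M := [set x | x \in I /\ exists l v, l < x < v /\
  forall y, l < y < v -> locally_mono lt s z y /\ preim_ub J z y].

Lemma piece_open s z : itv_open_ends I -> open (piece s z).
Proof.
move=> oI; apply: open_ooP => x [xI [l [v [/andP[lx xv] h]]]].
have [l' [v' [/andP[l'x xv'] sI]]] := open_ends_itv dlo (conj oI xI).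
exists (Order.max l l'), (Order.min v v'); rewrite !gt_max !lt_min lx l'x xv; split => // y.
rewrite !gt_max !lt_min => /andP[/andP[ly l'y] /andP[yv yv']].
split; first by apply: sI; rewrite l'y.
by exists l, v; rewrite ly.
Qed.

Lemma piece_sub s z x : piece s z x -> [/\ x \in I, preim_ub J z x & locally_mono lt s z x].
Proof. by move=> [xI [l [v [lxv /(_ x lxv)[]]]]]. Qed.

(** Two types would impose their relations on [x] and a point just to its right, but these relations
    exclude each other. *)
Lemma piece_disjoint s t z x : piece s z x -> piece t z x -> s = t.
Proof.
move=> /piece_sub[_ _ [l [v [/andP[lx xv] hs]]]] /piece_sub[_ _ [l' [v' [/andP[l'x xv'] ht]]]].
have [y /andP[xy]] : exists y, x < y < Order.min v v'.
  by case: dlo => + _ _; apply; rewrite lt_min xv.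
rewrite lt_min => /andP[yv yv'].
have {}hs : dir_rel lt s z x y by apply: hs; rewrite ?lx ?yv ?(lt_trans lx).
have {}ht : dir_rel lt t z x y by apply: ht; rewrite ?l'x ?yv' ?(lt_trans l'x).
have irr w : ~ lt z w w by case=> c [].
case: s hs => [[]|]; case: t ht => [[]|] //=; try tauto.
  by move=> h1 h2; case: (irr x); exact: lt_trans_ub h2 h1.
by move=> h1 h2; case: (irr x); exact: lt_trans_ub h1 h2.
Qed.

Hypothesis oI : itv_open_ends I.
Variable z : n.-tuple M.
Hypothesis tame_mono : forall s, tame (locally_mono lt s z `&` [set` I]).
Hypothesis tame_preim : tame (preim_ub J z `&` [set` I]).

(** The open part [U] of the tame intersection lies in its interior, hence in the piece; whatever
    the piece misses is therefore in the finite part. *)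
Lemma piece_fuoc s : finite_union_open_convex (piece s z) /\
  exists2 F, finite_set F &
    locally_mono lt s z `&` preim_ub J z `&` [set` I] `<=` F `|` piece s z.
Proof.
have [F [U [fF fU XE]]] := tame_setI (tame_mono s) tame_preim.
have XFU x : locally_mono lt s z x -> preim_ub J z x -> x \in I -> F x \/ U x.
  by move=> mx px xI; have : (F `|` U) x by rewrite -XE.
have UX : U `<=` piece s z.
  move=> x Ux; have Xx y : U y -> [/\ locally_mono lt s z y, preim_ub J z y & y \in I].
    by move=> Uy; have : (F `|` U) y by [right]; rewrite -XE => -[[? ?] []].
  split; first by case: (Xx x Ux).
  have [l [v [lxv sU]]] := open_itv_nbhs dlo (fuoc_open fU) Ux.
  by exists l, v; split => // y /sU/Xx[].
split.
  apply: (open_tame_fuoc dlo (F := F) (U := U)) => //; first exact: piece_open.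
  by move=> x /piece_sub[xI px mx]; apply: XFU.
exists F => // x [[mx px] xI]; case: (XFU x mx px xI) => [|/UX]; by [left|right].
Qed.

Lemma piece_locally s : locally_on (fun K => forall x y, K x -> K y -> x < y ->
  A x /\ A y /\ P z /\ dir_rel lt s z x y) (piece s z).
Proof.
move=> x xX; have [_ _ [l1 [v1 [lxv1 hmono]]]] := piece_sub xX.
have [l2 [v2 [lxv2 sX]]] := open_itv_nbhs dlo (piece_open s z oI) xX.
have [[lx1 xv1] [lx2 xv2]] := (andP lxv1, andP lxv2).
have sub y : Order.max l1 l2 < y < Order.min v1 v2 -> l1 < y < v1 /\ l2 < y < v2.
  by rewrite gt_max lt_min => /andP[/andP[-> ->] /andP[-> ->]].
exists `]Order.max l1 l2, Order.min v1 v2[%O; rewrite itv_ooE; split.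
- by apply: open_itv_oo; rewrite gt_max lt_min lx1 lx2 xv1.
- by move=> y /sub[_ /sX].
- move=> y y' /sub[y1 /sX/piece_sub[_ [Ay Pz _] _]] /sub[y'1 /sX/piece_sub[_ [Ay' _ _] _]] yy'.
  by do !split => //; apply: hmono.
Qed.

End Piece.

Lemma def_piece (m0 : M) I J s k (z : ctx n k -> n.-tuple M) (x : ctx n k -> M) :
  ctx_vars z -> ctx_var x -> ctx_definable S (fun g => piece I J s (z g) (x g)).
Proof.
move=> hz hx; apply: def_and; first exact: (def_itv _ m0).
apply: def_ex; apply: def_ex; apply: def_and.
  by apply: def_andb; apply: def_lt; apply: ctx_term_var; solve_var.
apply: def_all; apply: def_imp.
  by apply: def_andb; apply: def_lt; apply: ctx_term_var; solve_var.
apply: def_and; first by apply: (def_locally_mono def_lt_ub); solve_var.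
by apply: (def_preim_ub m0); solve_var.
Qed.

Definition lift_set (B : 'I_n -> interval M) (X : n.-tuple M -> set M) :=
  [set w : n.+1.-tuple M | exists x z, (box B z /\ X z x) /\ w = cons_tuple x z].

Lemma lift_setE B X x z : lift_set B X (cons_tuple x z) <-> box B z /\ X z x.
Proof.
split => [[x' [z' [hX /(congr1 val)[-> /val_inj ->]]]]|hX] //.
by exists x, z.
Qed.

Lemma lift_set_definable (m0 : M) B (X : n.-tuple M -> set M) :
  ctx_definable S (fun g : ctx n 1 => X g.1 g.2) -> definable S (lift_set B X).
Proof.
move=> hX; apply: (definable_cons (Q := fun g : ctx n 1 => box B g.1 /\ X g.1 g.2)).
apply: def_and => //; apply: (def_forall_ord m0) => i.
by apply: (def_itv _ m0); exact: (@ctx_vars_base _ _ _ 1 i).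
Qed.

Definition remainder I J z : set M :=
  [set x | x \in I /\ preim_ub J z x /\ ~ piece I J None z x /\
     ~ piece I J (Some false) z x /\ ~ piece I J (Some true) z x].

(** The remainder is finite because each of its points is either nowhere monotone or monotone of
    some type and lost on passing to the interior. *)
Lemma monotone_partition_of_tame (I J : interval M) (B : 'I_n -> interval M) a l v Z :
  open_itv_at a I -> [set` I] `<=` [set` `]l, v[%O] -> box B `<=` Z ->
  (forall z, Z z -> (forall s, tame (locally_mono lt s z `&` [set` `]l, v[%O])) /\
    finite_set (nowhere_mono lt z `&` [set` `]l, v[%O])) ->
  tame_slices A P f I J B -> monotone_partition A P f I J B.
Proof.
move=> [oI aI] Ilv BZ hZ tameJ.
have tame_preim z : box B z -> tame (preim_ub J z `&` [set` I]).
  move=> /tameJ; congr (tame (_ `&` _)).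
  by apply/seteqP; split => x /preim_ubE.
have tame_mono z s : box B z -> tame (locally_mono lt s z `&` [set` I]).
  by move=> /BZ/hZ[/(_ s)+ _]; exact: tame_sub_itv.
have on_lift X z : (forall x, X z x -> x \in I /\ preim_ub J z x) -> box B z ->
    slice (lift_set B X `&` preim_bar A P f J) z `&` [set` I] = X z.
  move=> hX Bz; apply/seteqP; split => [x [[/lift_setE[_ Xx] _] _]|x Xx] //.
  have [xI px] := hX x Xx; split => //; split; first exact/lift_setE.
  exact/preim_ubE.
have piece_sub2 s z x : piece I J s z x -> x \in I /\ preim_ub J z x.
  by move=> /piece_sub[].
exists (lift_set B (remainder I J)), (lift_set B (piece I J (Some false))),
  (lift_set B (piece I J (Some true))), (lift_set B (piece I J None)); split.
- split; apply: (lift_set_definable a); try by apply: (def_piece a); solve_var.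
  apply: def_and; first by apply: (def_itv _ a); solve_var.
  apply: def_and; first by apply: (def_preim_ub a); solve_var.
  by do 2?[apply: def_and]; apply: def_not; apply: (def_piece a); solve_var.
- apply/seteqP; split => w.
    by case=> [[[]|]|] [x [z [[Bz hX] ->]]]; (split; [apply/preim_ubE|exists x, z; split => //]);
      move: hX; by [case=> ? []|move=> /piece_sub[]].
  move=> [Jw [x [z [xI Bz w_eq]]]]; rewrite {w}w_eq in Jw *.
  have px : preim_ub J z x by exact/preim_ubE.
  have [h|h1] := pselect (piece I J None z x); first by right; apply/lift_setE.
  have [h|h2] := pselect (piece I J (Some true) z x); first by left; right; apply/lift_setE.
  have [h|h3] := pselect (piece I J (Some false) z x); first by left; left; right; apply/lift_setE.
  by left; left; left; apply/lift_setE.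
- have rem_piece s z x : remainder I J z x -> ~ piece I J s z x.
    by move=> [_ [_ [n1 [n2 n3]]]]; case: s => [[]|].
  move=> i j _ _ [w []]; rewrite !(tnth_nth set0).
  case: i => [[|[|[|[|i]]]] hi] //=; case: j => [[|[|[|[|j]]]] hj] //=;
    move=> [x [z [[_ hX] ->]]] /lift_setE[_ hY]; first [exact: val_inj
      | by have := piece_disjoint hX hY | by case: (rem_piece _ _ _ hX hY)
      | by case: (rem_piece _ _ _ hY hX)].
- move=> z [Bz Pz] on fz.
  have hpiece s := piece_fuoc oI (fun s => tame_mono z s Bz) (tame_preim z Bz) s.
  rewrite /on !on_lift //; try exact: piece_sub2; last by move=> x [? []].
  split.
  + have [_ fin] := hZ z (BZ _ Bz).
    have [F1 fF1 sF1] := (hpiece None).2; have [F2 fF2 sF2] := (hpiece (Some false)).2.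
    have [F3 fF3 sF3] := (hpiece (Some true)).2.
    apply: (@sub_finite_set _ _ ((nowhere_mono lt z `&` [set` `]l, v[%O]) `|`
      (F1 `|` (F2 `|` F3)))); last by rewrite !finite_setU.
    move=> x [xI [px [n1 [n2 n3]]]].
    have [h1|h1] := pselect (locally_mono lt None z x).
      by right; left; case: (sF1 x).
    have [h2|h2] := pselect (locally_mono lt (Some false) z x).
      by right; right; left; case: (sF2 x).
    have [h3|h3] := pselect (locally_mono lt (Some true) z x).
      by right; right; right; case: (sF3 x).
    by left; split; [case=> [[]|]|exact: Ilv].
  + split; first by case: (hpiece None).
    move=> x /(piece_locally oI)[K [xK sK hK]]; exists K; split => // y y' Ky Ky'.
    (* The values at [y] and [y'] are incomparable, hence equal. *)
    have [yy'|y'y|->] // := ltgtP y y'.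
      by have [Ay [Ay' [_ [h1 h2]]]] := hK _ _ Ky Ky' yy'; apply: nlt_eq.
    by have [Ay [Ay' [_ [h1 h2]]]] := hK _ _ Ky' Ky y'y; apply: nlt_eq.
  + split; first by case: (hpiece (Some false)).
    move=> x /(piece_locally oI)[K [xK sK hK]]; exists K; split => // y y' Ky Ky' yy'.
    by have [Ay [Ay' [_ h]]] := hK _ _ Ky Ky' yy'; apply/lt_clt.
  + split; first by case: (hpiece (Some true)).
    move=> x /(piece_locally oI)[K [xK sK hK]]; exists K; split => // y y' Ky Ky' yy'.
    by have [Ay [Ay' [_ h]]] := hK _ _ Ky Ky' yy'; apply/lt_clt.
Qed.

End UpperBounds.
End Partition.

Section Bounded.
Context {d : Order.disp_t} {M : orderTopologicalType d}.
Hypothesis dlo : dlo_without_endpoints M.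

(** Makes the endpoints of a small [J] available as parameters. An unbounded [J] would leave []c,
    e[] because [M] has no endpoints; an end beyond [c] or [e] would do so by density. *)
Lemma open_itv_sub_oo (b c e : M) (J : interval M) :
  open_itv_at b J -> [set` J] `<=` [set` `]c, e[%O] ->
  exists b1 b2, [/\ J = `]b1, b2[%O, c <= b1 < b & b < b2 <= e].
Proof.
move=> [oJ bJ] sJ; have [between below above] := dlo.
have {}sJ y : y \in J -> c < y < e by move=> /sJ; rewrite /= in_itv.
have /andP[cb be] := sJ b bJ.
have [y yc] := below c; have [w ew] := above e.
have nyJ : y \notin J by apply/negP => /sJ; rewrite (lt_gtF yc).
have nwJ : w \notin J by apply/negP => /sJ; rewrite (lt_gtF ew) andbF.
case: J oJ bJ sJ nyJ nwJ => [[[] s|[]] [[] t|[]]] //= _; rewrite !in_itv /= => bJ sJ nyJ nwJ.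
- exists s, t; have /andP[sb bt] := bJ.
  split; rewrite ?sb ?bt ?andbT //= leNgt; apply/negP.
    move=> /[dup] sc /between[u /andP[su uc]].
    have : c < u < e by apply: sJ; rewrite in_itv /= su (lt_trans uc) ?(lt_trans cb).
    by rewrite (lt_gtF uc).
  move=> /between[u /andP[eu ut]].
  have : c < u < e by apply: sJ; rewrite in_itv /= ut (lt_trans sb) ?(lt_trans be).
  by rewrite (lt_gtF eu) andbF.
- by move: nwJ; rewrite andbT; rewrite andbT in bJ; rewrite (lt_trans bJ) ?(lt_trans be).
- by move: nyJ; rewrite (lt_trans yc) ?(lt_trans cb).
Qed.

End Bounded.

Unset Implicit Arguments.
Set Strict Implicit.

Local Close Scope order_scope.

Theorem theorem3p6 (L : language) (d : Order.disp_t)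
    (M : orderTopologicalType d) (S : structure L M)
    (hM : dlo_without_endpoints M)
    (hS : unif_locally_weakly_ominimal2 S)
    (n : nat) (A : set M) (P : set (n.-tuple M))
    (f : n.+1.-tuple M -> completion S)
    (hA : definable1 S A) (hP : definable S P) (oA : open A)
    (hf : definable_fun (prodset A P) f)
    (a b : M) (p : n.-tuple M) :
  (exists (I0 J0 : interval M) (B0 : 'I_n -> interval M),
    [/\ open_itv_at a I0, open_itv_at b J0, open_box_at p B0 &
      forall (I J : interval M) (B : 'I_n -> interval M),
        open_itv_at a I -> open_itv_at b J -> open_box_at p B ->
        [set` I] `<=` [set` I0] -> [set` J] `<=` [set` J0] ->
        box B `<=` box B0 ->
        tame_slices A P f I J B /\ monotone_partition A P f I J B]) /\
  (unif_locally_weakly_ominimal1 S ->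
    exists2 I0 : interval M, open_itv_at a I0 &
      forall I : interval M, open_itv_at a I -> [set` I] `<=` [set` I0] ->
        tame_slices A P f I `]-oo, +oo[%O (fun=> `]-oo, +oo[%O) /\
        monotone_partition A P f I `]-oo, +oo[%O (fun=> `]-oo, +oo[%O)).
Proof.
have [ub [ub_le ubE def_ub]] := definable_fun_upper_bounds hf.
have lt_tame V VI unifV := @lt_family_tame L d M S hM n V VI unifV _
  (lt_trans_ub ub_le) (nlt_trans_ub (ub := ub)) (def_lt_ub def_ub) a.
split => [|hS1].
  have [l1 [v1 [Z1 [/andP[la1 av1] VZ1 hmono]]]] := lt_tame _ (@box_nbhsI _ _ _ p) (uniform_over2 hM p hS).
  (* The two parameters are the endpoints of [J], so one choice of neighbourhoods serves for all
     small [J]. *)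
  pose Q (g : ctx n 3) := preim_ub A P ub `]g.1.1.2, g.1.2[%O g.1.1.1 g.2.
  have defQ : ctx_definable S Q.
    apply: (def_preim_ub_oo hA hP def_ub); last 3 first; try exact: (@ctx_vars_base _ _ _ 3).
    - exact: (@ctx_var_last _ _ _ 2).
    - exact: (@ctx_var_drop _ _ _ 2 _ _ (@ctx_var_last _ _ _ _)).
    - exact: (@ctx_var_drop _ _ _ 1 _ _ (@ctx_var_last _ _ _ _)).
  have [l2 [v2 [l' [v' [Z2 [/andP[la2 av2] /andP[l'b bv'] VZ2 hQ]]]]]] := uniform_over2 hM p hS defQ a b.
  have [lo [hi [plh sub_lh]]] := box_nbhsI VZ1 VZ2.
  have [between _ _] := hM.
  (* An endpoint of [J] may equal [c] or [e], so these are taken strictly inside []l', v'[], where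
     tameness is known. *)
  have [[c /andP[l'c cb]] [e /andP[be ev']]] := (between _ _ l'b, between _ _ bv').
  exists `]Order.max l1 l2, Order.min v1 v2[%O, `]c, e[%O, (fun i => `]lo i, hi i[%O).
  split.
  - by apply: open_itv_oo; rewrite gt_max lt_min la1 la2 av1.
  - by apply: open_itv_oo; rewrite cb.
  - by move=> i; apply: open_itv_oo.
  move=> I J B aI bJ _ sI sJ sB.
  have {}sB z : box B z -> Z1 z /\ Z2 z.
    by move=> /sB hz; apply: sub_lh => i; have := hz i; rewrite in_itv.
  have sI1 : [set` I] `<=` [set` `]l1, v1[%O].
    by apply: subset_trans sI _; rewrite !itv_ooE => x; rewrite /= gt_max lt_min => /andP[/andP[-> _] /andP[->]].
  have sI2 : [set` I] `<=` [set` `]l2, v2[%O].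
    by apply: subset_trans sI _; rewrite !itv_ooE => x; rewrite /= gt_max lt_min => /andP[/andP[_ ->] /andP[_ ->]].
  have tameJ : tame_slices A P f I J B.
    have [b1 [b2 [-> /andP[cb1 b1b] /andP[bb2 b2e]]]] := open_itv_sub_oo hM bJ sJ.
    move=> z /sB[_ Z2z]; apply: tame_sub_itv sI2 _; first by case: aI.
    have -> : slice (preim_bar A P f `]b1, b2[%O) z = [set y | Q (z, b1, b2, y)].
      by apply/seteqP; split => y hy; exact/(preim_ubE ubE `]b1, b2[%O).
    apply: hQ => //; first by rewrite (lt_le_trans l'c) ?(lt_trans b1b).
    by rewrite (lt_trans l'b) ?(le_lt_trans b2e).
  split => //; apply: (monotone_partition_of_tame hM hA hP ub_le ubE def_ub aI sI1 _ hmono tameJ).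
  by move=> z /sB[].
(* For the first kind the only neighbourhood is all of [M^n]. *)
have VI1 (Z Z' : set (n.-tuple M)) : [set setT] Z -> [set setT] Z' -> [set setT] (Z `&` Z').
  by move=> -> ->; rewrite /= setIT.
have [l1 [v1 [Z1 [/andP[la1 av1] -> hmono]]]] := lt_tame _ VI1 (uniform_over1 hM hS1).
(* Here [J] is all of [M] and no endpoint varies; the two parameters may take any value, such as
   [b]. *)
pose Q (g : ctx n 3) := preim_ub A P ub `]-oo, +oo[%O g.1.1.1 g.2.
have defQ : ctx_definable S Q.
  by apply: (def_preim_ub hA hP def_ub a); [exact: (@ctx_vars_base _ _ _ 3)|exact: (@ctx_var_last _ _ _ 2)].
have [l2 [v2 [l' [v' [Z2 [/andP[la2 av2] /andP[l'b bv'] -> hQ]]]]]] := uniform_over1 hM hS1 defQ a b.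
exists `]Order.max l1 l2, Order.min v1 v2[%O => [|I aI sI].
  by apply: open_itv_oo; rewrite gt_max lt_min la1 la2 av1.
have sI1 : [set` I] `<=` [set` `]l1, v1[%O].
  by apply: subset_trans sI _; rewrite !itv_ooE => x; rewrite /= gt_max lt_min => /andP[/andP[-> _] /andP[->]].
have sI2 : [set` I] `<=` [set` `]l2, v2[%O].
  by apply: subset_trans sI _; rewrite !itv_ooE => x; rewrite /= gt_max lt_min => /andP[/andP[_ ->] /andP[_ ->]].
have tameJ : tame_slices A P f I `]-oo, +oo[%O (fun=> `]-oo, +oo[%O).
  move=> z _; apply: tame_sub_itv sI2 _; first by case: aI.
  have -> : slice (preim_bar A P f `]-oo, +oo[%O) z = [set y | Q (z, b, b, y)].
    by apply/seteqP; split => y hy; exact/(preim_ubE ubE `]-oo, +oo[%O).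
  by apply: hQ => //; rewrite l'b.
split => //.
exact: (monotone_partition_of_tame hM hA hP ub_le ubE def_ub aI sI1 _ hmono tameJ).
Qed.
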